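(* Let $\mathcal{G}$ be a compact metric graph with $\delta$-type vertex conditions of strengths $\gamma(v)\in(-\infty,\infty]$, and let $\widetilde{\mathcal{G}}$ be obtained from $\mathcal{G}$ by either (1) gluing two vertices, or (2) increasing the strength of the $\delta$-condition at a single vertex from $\gamma$ to some $\gamma'\in(\gamma,\infty]$. Then the eigenvalues satisfy the interlacing inequalities $$\lambda_k(\mathcal{G})\le\lambda_k(\widetilde{\mathcal{G}})\le\lambda_{k+1}(\mathcal{G})\le\lambda_{k+1}(\widetilde{\mathcal{G}}),\qquad k\ge 1.$$ Moreover, if a given value $\Lambda$ has multiplicities $m$ and $\widetilde{m}$ in the spectra of $\mathcal{G}$ and $\widetilde{\mathcal{G}}$, respectively, then $|m-\widetilde{m}|\le 1$ and, with $L^2(\mathcal{G})$ and $L^2(\widetilde{\mathcal{G}})$ canonically identified, the intersection of the respective $\Lambda$-eigenspaces has dimension $\min(m,\widetilde{m})$.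
   Context: A compact metric graph $\mathcal{G}$ has finitely many vertices and edges, each edge $e$ being identified with an interval $[0,|e|]$, $0<|e|<\infty$; loops and multiple edges are allowed and $\mathcal{G}$ need not be connected. Each vertex $v$ carries a strength $\gamma(v)\in(-\infty,\infty]$: $\gamma(v)=0$ is the natural condition, $\gamma(v)\in\mathbb{R}\setminus\{0\}$ is a $\delta$-condition, $\gamma(v)=\infty$ is the Dirichlet condition. The associated Laplacian is $-d^2/dx^2$ on each edge, on edgewise $H^2$-functions $f$ that are continuous at the vertices and satisfy $\sum_{e\sim v}\partial_\nu f|_e(v)+\gamma(v)f(v)=0$ (with $\partial_\nu$ the derivative pointing out of the edge towards $v$) if $\gamma(v)<\infty$, and $f(v)=0$ if $\gamma(v)=\infty$. Its quadratic form is $a(f)=\int_{\mathcal{G}}|f'|^2\,dx+\sum_{v:\gamma(v)<\infty}\gamma(v)|f(v)|^2$ on the functions which are $H^1$ on every edge, continuous on $\mathcal{G}$ and zero at all Dirichlet vertices. The operator is self-adjoint, bounded below, with discrete spectrum $\lambda_1(\mathcal{G})\le\lambda_2(\mathcal{G})\le\dots$ (repeated according to multiplicity). Gluing vertices $v_1,\dots,v_m$ means identifying them to a single vertex $v_0$ with strength $\gamma(v_0)=\gamma(v_1)+\dots+\gamma(v_m)$ (with $\gamma+\infty=\infty$, $\infty+\infty=\infty$). Gluing does not change the edge set, so $L^2$ of both graphs is canonically identified with $\bigoplus_e L^2(0,|e|)$. *)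

(* Defs.v *)
From HB Require Import structures.
From mathcomp Require Import all_boot all_order all_algebra.
From mathcomp Require Import all_classical all_reals all_analysis.
From mathcomp Require Import complex.

Set Implicit Arguments.
Unset Strict Implicit.
Unset Printing Implicit Defensive.

Import Order.TTheory GRing.Theory Num.Theory.
Import numFieldNormedType.Exports.

Local Open Scope classical_set_scope.
Local Open Scope ring_scope.
Local Open Scope complex_scope.

(** Compact metric graphs with edge set [E] and delta-type conditions. An edge
    [e] is the interval from 0 to [len e]; its end 0 is [(e, false)] and its end
    [len e] is [(e, true)]. The vertices partition the set of edge ends, so each
    vertex is the end of some edge; loops, multiple edges and disconnected
    graphs are allowed. The strength [+oo] is the Dirichlet condition. *)
Record metric_graph (R : realType) (E : finType) := MetricGraph {
  vertex : finType;
  len : E -> R;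
  len_gt0 : forall e, 0 < len e;
  endpoint : E * bool -> vertex;
  endpoint_surj : forall v, exists p, endpoint p = v;
  strength : vertex -> \bar R;
  strength_gtNy : forall v, (-oo < strength v)%E }.

Section Surgery.
Context (R : realType) (E : finType) (G : metric_graph R E).

Section Glue.
Context (v1 v2 : vertex G) (v12 : v1 != v2).

(** The glued vertex is represented by [v1]; [v2] is removed. *)
Definition glue_vertex : finType := {w : vertex G | w != v2}.

Definition glue_map (v : vertex G) : glue_vertex := insubd (exist _ v1 v12) v.

Definition glue_endpoint (p : E * bool) : glue_vertex :=
  glue_map (endpoint G p).

Definition glue_strength (w : glue_vertex) : \bar R :=
  if val w == v1 then (strength v1 + strength v2)%E else strength (val w).

Lemma glue_endpoint_surj w : exists p, glue_endpoint p = w.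
Proof.
have [p pw] := endpoint_surj (val w); exists p.
by rewrite /glue_endpoint /glue_map pw valKd.
Qed.

Lemma glue_strength_gtNy w : (-oo < glue_strength w)%E.
Proof.
rewrite /glue_strength; case: ifP => _; last exact: strength_gtNy.
rewrite ltNye adde_eq_ninfty negb_or -!ltNye.
by apply/andP; split; exact: strength_gtNy.
Qed.

Definition glue : metric_graph R E :=
  MetricGraph (len_gt0 G) glue_endpoint_surj glue_strength_gtNy.

End Glue.

Section Raise.
Context (v : vertex G) (g : \bar R) (vg : (strength v < g)%E).

Definition raise_strength (w : vertex G) : \bar R :=
  if w == v then g else strength w.

Lemma raise_strength_gtNy w : (-oo < raise_strength w)%E.
Proof.
rewrite /raise_strength; case: ifP => _; last exact: strength_gtNy.
exact: lt_trans (strength_gtNy v) vg.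
Qed.

Definition raise : metric_graph R E :=
  MetricGraph (len_gt0 G) (endpoint_surj (m := G)) raise_strength_gtNy.

End Raise.

Inductive surgery : metric_graph R E -> Prop :=
| Surgery_glue v1 v2 (v12 : v1 != v2) : surgery (glue v12)
| Surgery_raise v g (vg : (strength v < g)%E) : surgery (raise vg).

End Surgery.

Section Sobolev.
Context (R : realType).
Local Notation mu := (@lebesgue_measure R).

Definition is_L2 (l : R) (f : R -> R) : Prop :=
  f \_ `[0, l] \in Lfun mu 2%:E.

(** [f] is the continuous representative of an element of H^1(0, l) whose weak
    derivative is represented by [f1]. *)
Definition is_H1 (l : R) (f f1 : R -> R) : Prop :=
  is_L2 l f1 /\
  forall x, x \in `[0, l] -> f x = f 0 + (\int[mu]_(t in `[0, x]) f1 t)%R.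

(** [f] is the C^1 representative of an element of H^2(0, l), [f1] is its
    continuous derivative and [f2] represents its second weak derivative. *)
Definition is_H2 (l : R) (f f1 f2 : R -> R[i]) : Prop :=
  [/\ is_H1 l (fun x => complex.Re (f x)) (fun x => complex.Re (f1 x)),
      is_H1 l (fun x => complex.Im (f x)) (fun x => complex.Im (f1 x)),
      is_H1 l (fun x => complex.Re (f1 x)) (fun x => complex.Re (f2 x)) &
      is_H1 l (fun x => complex.Im (f1 x)) (fun x => complex.Im (f2 x))].

End Sobolev.

Section Laplacian.
Context (R : realType) (E : finType) (G : metric_graph R E).

(** Elements of L^2(G), the direct sum of the complex spaces L^2(0, len e), are
    represented by functions in [E -> R -> R[i]] modulo [eq_L2]. *)
Definition eq_L2 (f g : E -> R -> R[i]) : Prop :=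
  forall e, ae_eq (@lebesgue_measure R) `[0, len G e]%classic (f e) (g e).

Definition trace (f : E -> R -> R[i]) (p : E * bool) : R[i] :=
  f p.1 (if p.2 then len G p.1 else 0).

(** The derivative at the end [p] in the direction out of the edge, where [f1]
    is the derivative along the edge. *)
Definition normal_derivative (f1 : E -> R -> R[i]) (p : E * bool) : R[i] :=
  if p.2 then trace f1 p else - trace f1 p.

(** [c] is the common value of [f] at [v]; both ends of a loop at [v] enter the
    sum of the normal derivatives. *)
Definition vertex_condition (f f1 : E -> R -> R[i]) (v : vertex G) : Prop :=
  exists c : R[i], (forall p, endpoint G p = v -> trace f p = c) /\
    match strength v with
    | g%:E => \sum_(p | endpoint G p == v) normal_derivative f1 p + g%:C * c = 0
    | _ => c = 0
    end.

(** The graph of the Laplacian as an operator in L^2(G): the class of [f] is in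
    its domain and is mapped to the class of [g]. *)
Definition laplacian (f g : E -> R -> R[i]) : Prop :=
  exists u u1 u2 : E -> R -> R[i],
    [/\ forall e, is_H2 (len G e) (u e) (u1 e) (u2 e),
        forall v, vertex_condition u u1 v,
        eq_L2 f u &
        eq_L2 g (fun e x => - u2 e x)].

Definition laplacian_eigenspace (L : R) (f : E -> R -> R[i]) : Prop :=
  laplacian f (fun e x => L%:C * f e x).

(** The subspace [W] of L^2(G) has complex dimension [n]. *)
Definition has_dim (W : (E -> R -> R[i]) -> Prop) (n : nat) : Prop :=
  exists b : 'I_n -> E -> R -> R[i],
    [/\ forall i, W (b i),
        forall c : 'I_n -> R[i],
          eq_L2 (fun e x => \sum_(i < n) c i * b i e x) (fun _ _ => 0) ->
          forall i, c i = 0 &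
        forall f, W f -> exists c : 'I_n -> R[i],
          eq_L2 f (fun e x => \sum_(i < n) c i * b i e x)].

Definition multiplicity (L : R) (m : nat) : Prop :=
  has_dim (laplacian_eigenspace L) m.

(** [lam] lists the eigenvalues in nondecreasing order, repeated according to
    multiplicity; [lam 0] is the lowest one. *)
Definition eigenvalue_sequence (lam : nat -> R) : Prop :=
  (forall k, lam k <= lam k.+1) /\
  forall L, exists2 m, multiplicity L m &
    ([set k | lam k = L] #= `I_m)%card.

End Laplacian.

(* Main.v *)
From HB Require Import structures.
From mathcomp Require Import all_boot all_order all_algebra.
From mathcomp Require Import all_classical all_reals all_analysis.
From mathcomp Require Import complex measurable_realfun.
From mathcomp Require Import ring lra zify.
Require Import Defs.

(* On an edge segment of length 2h with L h^2 < 1 a solution of u'' = - L u is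
   determined by its values at the two ends. So, after subdividing the edges
   finely enough for a given T, for every L <= T the L-eigenspace is isomorphic
   to the radical of a real quadratic form Q_L on a finite-dimensional space W
   of values at the subdivision points. Q_L is continuous and strictly
   decreasing in L and positive definite for very negative L. Following its
   negative index as L grows, one sees that the index of Q_T is the number of
   eigenvalues below T, counted with multiplicity. Both surgeries either
   restrict Q_L to a hyperplane of W or add a positive multiple of the square of
   a linear functional, so everything reduces to rank-one changes of quadratic
   forms. *)

Set Implicit Arguments.
Unset Strict Implicit.
Unset Printing Implicit Defensive.

Import Order.TTheory GRing.Theory Num.Theory.
Import numFieldNormedType.Exports.

Local Open Scope ring_scope.

(** * Real quadratic forms *)

Section Subspaces.
Context (K : fieldType) (V : vectType K).

(** [Q_L(y)] is the energy, the integral of [u'^2 - L u^2] plus the vertex terms, of the function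
    [u] that interpolates [y] by solutions of [u'' = - L u] on the segments. By Green's formula [y]
    is in the radical when the derivatives of [u] match at interior points and satisfy the condition
    at each vertex, that is, when [u] is an eigenfunction. The derivative of [Q_L] in [L] is minus
    the integral of [u^2], whence the monotonicity. The bound on [h] keeps [L] below the first
    Dirichlet eigenvalue of each segment, so sampling loses no eigenfunction. Surgery leaves the
    edges alone, so the forms of both graphs live on one space of samples. The obstacle is that
    [eigenvalue_sequence] gives only the order and the sizes of the level sets of [lam], not a
    min-max formula. Its substitute is the equivalence of [lam k < t] with negative index at least
    [k + 1]; interlacing follows by taking for [t] the eigenvalue that would violate it. *)

Lemma lfun_of_linear (W : vectType K) (f : V -> W) :
  linear f -> exists F : 'Hom(V, W), F =1 f.
Proof.
move=> fl; pose L : {linear V -> W} := HB.pack f (GRing.isLinear.Build K V W _ f fl).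
by exists (linfun L) => x; rewrite lfunE.
Qed.

(** Among the subspaces contained in [P] one has maximal dimension; a vector of [P] outside it would
    span a larger one. *)
Lemma vspace_of_pred (P : V -> Prop) :
  P 0 -> (forall a x y, P x -> P y -> P (a *: x + y)) ->
  {U : {vspace V} | forall x, x \in U <-> P x}.
Proof.
move=> P0 Plin; apply: cid.
pose Q n := `[< exists2 U : {vspace V}, \dim U = n & forall x, x \in U -> P x >].
have Q0 : exists n, Q n.
  by exists 0%N; apply/asboolP; exists 0%VS; rewrite ?dimv0// => x; rewrite memv0 => /eqP->.
have Qb n : Q n -> (n <= \dim {:V})%N.
  by move=> /asboolP[U <- _]; apply/dimvS/subvf.
case: (ex_maxnP Q0 Qb) => n /asboolP[U dU UP] nmax; exists U => x; split; first exact: UP.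
move=> Px; apply/negPn/negP => xU.
have : Q (\dim (U + <[x]>)%VS).
  apply/asboolP; exists (U + <[x]>)%VS => // y /memv_addP[u uU [w /vlineP[a ->] ->]].
  by rewrite addrC; apply: Plin => //; exact: UP.
move=> /nmax; rewrite -dU => h; have [_] := dimv_leqif_sup (addvSl U <[x]>).
by rewrite eqn_leq h dimvS ?addvSl//= subv_add subvv /= -memvE (negbTE xU).
Qed.

Lemma dim_common_kernel k (f : 'I_k -> V -> K) (W : {vspace V}) :
  (forall i a x y, f i (a *: x + y) = a * f i x + f i y) ->
  exists2 U : {vspace V}, (forall x, x \in U <-> x \in W /\ forall i, f i x = 0) &
    (\dim W <= \dim U + k)%N.
Proof.
move=> flin; pose g x : 'rV[K]_k := \row_i f i x.
have gl : linear g by move=> a x y; apply/rowP => i; rewrite !mxE flin.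
have [F Fg] := lfun_of_linear gl.
exists (W :&: lker F)%VS.
  move=> x; rewrite memv_cap memv_ker Fg; split.
    by move=> /andP[-> /eqP/rowP gx]; split=> // i; have := gx i; rewrite !mxE.
  by move=> [-> fx]; apply/eqP/rowP => i; rewrite !mxE fx.
rewrite -(limg_ker_dim F W) leq_add2l (leq_trans (dimvS (subvf _)))//.
by rewrite dimvf /dim /= mul1n.
Qed.

Lemma subspace_of_dim (U : {vspace V}) k :
  (k <= \dim U)%N -> exists2 U' : {vspace V}, (U' <= U)%VS & \dim U' = k.
Proof.
move=> kU; exists <<take k (vbasis U)>>%VS.
  by apply/span_subvP => x /mem_take; exact: vbasis_mem.
have /basis_free : basis_of U (vbasis U) by exact: vbasisP.
rewrite -[X in free X](cat_take_drop k) => /catl_free; rewrite /free => /eqP->.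
by rewrite size_takel ?size_tuple// => /eqP.
Qed.

End Subspaces.

Section Forms.
Context (K : realFieldType) (V : vectType K).
Implicit Types (q : V -> V -> K) (U W : {vspace V}).

Record symform q : Prop := SymForm {
  form_lin : forall a x y z, q (a *: x + y) z = a * q x z + q y z;
  formC : forall x y, q x y = q y x }.

Section FormTheory.
Context q (qs : symform q).

Lemma form_linr a x y z : q z (a *: x + y) = a * q z x + q z y.
Proof. by rewrite formC// form_lin// ![q z _]formC. Qed.

Lemma form0l x : q 0 x = 0.
Proof. by have := form_lin qs 1 0 0 x; rewrite scaler0 addr0 mul1r; lra. Qed.

Lemma formDl x y z : q (x + y) z = q x z + q y z.
Proof. by rewrite -[x]scale1r form_lin// mul1r scale1r. Qed.

Lemma formZl a x z : q (a *: x) z = a * q x z.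
Proof. by rewrite -[a *: x]addr0 form_lin// form0l addr0. Qed.

Lemma formDr x y z : q z (x + y) = q z x + q z y.
Proof. by rewrite formC// formDl ![q z _]formC. Qed.

Lemma formZr a x z : q z (a *: x) = a * q z x.
Proof. by rewrite formC// formZl formC. Qed.

Lemma form_suml I (r : seq I) (P : pred I) (F : I -> V) z :
  q (\sum_(i <- r | P i) F i) z = \sum_(i <- r | P i) q (F i) z.
Proof. by elim/big_ind2 : _ => [|x1 x2 y1 y2 <- <-|//]; rewrite ?form0l ?formDl. Qed.

Lemma form_sumr I (r : seq I) (P : pred I) (F : I -> V) z :
  q z (\sum_(i <- r | P i) F i) = \sum_(i <- r | P i) q z (F i).
Proof. by rewrite formC// form_suml; apply: eq_bigr => i _; rewrite formC. Qed.

(* If q(x, x) = 0 but q(x, y) <> 0 then q(y + t x, y + t x) is linear in t. *)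
Lemma psd_isotropic U x y : (forall z, z \in U -> 0 <= q z z) ->
  x \in U -> y \in U -> q x x = 0 -> q x y = 0.
Proof.
move=> q0 xU yU qx0; apply/eqP/negP => /negP qxy.
pose t := - (q y y + 1) / (2 * q x y).
have := q0 (t *: x + y) (memvD (memvZ _ xU) yU).
rewrite form_lin// !form_linr qx0 [q y x]formC//.
suff -> : t * (t * 0 + q x y) + (t * q x y + q y y) = -1 by rewrite ler0N1.
by rewrite /t; field.
Qed.

Lemma psd_cauchy_schwarz U x y : (forall z, z \in U -> 0 <= q z z) ->
  x \in U -> y \in U -> q x y ^+ 2 <= q x x * q y y.
Proof.
move=> q0 xU yU; have := q0 y yU; rewrite le_eqVlt => /predU1P[/esym qy0|qy0].
  by rewrite formC// (psd_isotropic q0)// qy0 mulr0 expr0n.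
(* The vector is the component of [x] that is q-orthogonal to [y]. *)
have := q0 (- (q x y / q y y) *: y + x) (memvD (memvZ _ yU) xU).
rewrite form_lin// !form_linr [q y x]formC// => h.
suff : 0 <= (q x x * q y y - q x y ^+ 2) / q y y by rewrite pmulr_lge0 ?invr_gt0// subr_ge0.
by apply: le_trans h _; rewrite le_eqVlt; apply/orP; left; apply/eqP; field; rewrite gt_eqF.
Qed.

End FormTheory.

Definition radical_spec q W (qs : symform q) : {U : {vspace V} |
  forall x, x \in U <-> x \in W /\ forall y, y \in W -> q x y = 0}.
Proof.
apply: vspace_of_pred => [|a x y [xW qx] [yW qy]].
  by split=> [|y _]; rewrite ?mem0v ?form0l.
split=> [|z zW]; first by rewrite memvD// memvZ.
by rewrite form_lin// qx// qy// mulr0 addr0.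
Qed.

Definition radical q W (qs : symform q) := sval (radical_spec W qs).

Lemma radicalP q W (qs : symform q) x :
  x \in radical W qs <-> x \in W /\ forall y, y \in W -> q x y = 0.
Proof. exact: (svalP (radical_spec W qs)). Qed.

Definition neg_on q U := forall x, x \in U -> x != 0 -> q x x < 0.
Definition pos_on q U := forall x, x \in U -> x != 0 -> 0 < q x x.

(* The negative index of q on W is at least n. *)
Definition index_ge q W n := exists U, [/\ (U <= W)%VS, \dim U = n & neg_on q U].

Lemma index_ge0 q W : index_ge q W 0.
Proof.
exists 0%VS; rewrite sub0v dimv0; split=> // x.
by rewrite memv0 => ->.
Qed.

Lemma index_ge_dim q W n : index_ge q W n -> (n <= \dim W)%N.
Proof. by move=> [U [UW <- _]]; exact: dimvS. Qed.

Lemma index_geW q W n k : (k <= n)%N -> index_ge q W n -> index_ge q W k.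
Proof.
move=> kn [U [UW dU Un]]; rewrite -dU in kn.
have [U' U'U dU'] := subspace_of_dim kn.
by exists U'; split=> [||x /(subvP U'U)]; [exact: subv_trans UW| |exact: Un].
Qed.

(** A negative and a positive subspace meet only in 0. *)
Lemma index_ge_codim q W U n : index_ge q W n -> pos_on q U -> (U <= W)%VS ->
  (n + \dim U <= \dim W)%N.
Proof.
move=> [N [NW <- Nn]] Up UW.
rewrite -dimv_disjoint_sum ?dimvS ?subv_add ?NW//.
apply/eqP; rewrite -subv0; apply/subvP => x; rewrite memv_cap memv0 => /andP[xN xU].
by apply/negPn/negP => x0; have := Nn _ xN x0; have := Up _ xU x0; lra.
Qed.

(** Adding a radical vector does not change [q(x, x)], so [q] is nonpositive on the sum of [N] and
    the radical, and the strictly smaller [q'] is negative there. This is the jump of the index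
    across an eigenvalue. *)
Lemma index_ge_radical q q' W n (qs : symform q) : symform q' ->
  (forall x, x \in W -> x != 0 -> q' x x < q x x) ->
  index_ge q W n -> index_ge q' W (n + \dim (radical W qs)).
Proof.
move=> qs' q'q [N [NW <- Nn]]; set Z := radical W qs.
have ZW : (Z <= W)%VS by apply/subvP => x /radicalP[].
exists (N + Z)%VS; split; first by rewrite subv_add NW.
  rewrite dimv_disjoint_sum//; apply/eqP; rewrite -subv0; apply/subvP => x.
  rewrite memv_cap memv0 => /andP[xN /radicalP[xW Zx]].
  by apply/negPn/negP => /(Nn _ xN); rewrite Zx// ltxx.
move=> _ /memv_addP[x xN [z zZ ->]] xz0.
have xW := subvP NW _ xN; have [zW qz] := (radicalP W qs z).1 zZ.
apply: lt_le_trans (q'q _ (memvD xW zW) xz0) _.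
rewrite formDl// (qz _ (memvD xW zW)) addr0 formDr// [q x z]formC// qz// addr0.
by have [->|/(Nn _ xN)/ltW//] := eqVneq x 0; rewrite form0l.
Qed.

(* Take a negative subspace N of maximal dimension; on its q-orthogonal
   complement q is semidefinite, hence definite modulo the radical. *)
Lemma sylvester q W (qs : symform q) : exists n U, [/\ index_ge q W n, (U <= W)%VS,
  pos_on q U & (\dim W <= \dim U + n + \dim (radical W qs))%N].
Proof.
pose Q n := `[< index_ge q W n >].
have Q0 : exists n, Q n by exists 0%N; apply/asboolP; exact: index_ge0.
have Qb n : Q n -> (n <= \dim W)%N by move=> /asboolP /index_ge_dim.
case: (ex_maxnP Q0 Qb) => n /asboolP[N [NW dN Nn]] nmax.
pose b (i : 'I_(\dim N)) x := q x (vbasis N)`_i.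
have [U UP dU] := @dim_common_kernel _ V (\dim N) b W (fun i a x y => form_lin qs a x y _).
have UN x y : x \in U -> y \in N -> q x y = 0.
  move=> /UP[_ xb] /coord_vbasis->; rewrite form_sumr// big1// => i _.
  by rewrite formZr// [q _ _]xb mulr0.
have UW : (U <= W)%VS by apply/subvP => x /UP[].
have U0 x : x \in U -> 0 <= q x x.
  move=> xU; rewrite leNgt; apply/negP => qx.
  have xN : x \notin N by apply/negP => /(UN _ _ xU) q0; rewrite q0 ltxx in qx.
  have x0 : x != 0 by apply: contra xN => /eqP->; rewrite mem0v.
  suff : (n.+1 <= n)%N by rewrite ltnn.
  apply: nmax; apply/asboolP; exists (N + <[x]>)%VS; split.
  - by rewrite subv_add NW -memvE (subvP UW).
  - rewrite dimv_disjoint_sum ?dim_vline ?x0 ?dN ?addn1//.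
    apply/eqP; rewrite -subv0; apply/subvP => y; rewrite memv_cap memv0.
    move=> /andP[yN /vlineP[a ya]]; rewrite ya scaler_eq0 (negbTE x0) orbF.
    apply/negPn/negP => a0; move: yN; rewrite ya memvE => yN; move/negP: xN; apply.
    by rewrite -(scalerK a0 x) memvZ.
  - move=> _ /memv_addP[y yN [_ /vlineP[a ->] ->]] yx0.
    rewrite formDl// !formDr// !formZl// !formZr// [q y x]formC// (UN x y)// !mulr0 addr0 add0r.
    have [y0|y0] := eqVneq y 0.
      rewrite y0 form0l// add0r mulrA -expr2 pmulr_rlt0// exprn_even_gt0//=.
      by apply: contra yx0 => /eqP->; rewrite y0 scale0r addr0.
    have := Nn _ yN y0; have : a * (a * q x x) <= 0.
      by rewrite mulrA -expr2 mulr_ge0_le0 ?sqr_ge0// ltW.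
    by lra.
have NU : (N :&: U = 0)%VS.
  apply/eqP; rewrite -subv0; apply/subvP => x; rewrite memv_cap memv0 => /andP[xN xU].
  by apply/negPn/negP => /(Nn _ xN); rewrite UN// ltxx.
have NUW : (N + U = W)%VS.
  apply/eqP; rewrite eqEdim subv_add NW UW dimv_disjoint_sum//.
  by rewrite addnC.
exists n, (U :\: radical W qs)%VS; split.
- by exists N.
- exact: subv_trans (diffvSl _ _) UW.
- move=> x xD x0; have xU := subvP (diffvSl _ _) _ xD.
  rewrite lt_def U0// andbT; apply/negP => /eqP qx0.
  suff : x \in ((U :\: radical W qs) :&: radical W qs)%VS.
    by rewrite capv_diff memv0 (negbTE x0).
  rewrite memv_cap xD; apply/radicalP; split; first exact: (subvP UW).
  rewrite -NUW => _ /memv_addP[y yN [z zU ->]].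
  by rewrite formDr// UN// add0r (psd_isotropic qs U0 xU zU qx0).
- have := dimv_cap_compl U (radical W qs).
  have : (\dim (U :&: radical W qs) <= \dim (radical W qs))%N by rewrite dimvS ?capvSr.
  by rewrite -dN; lia.
Qed.

End Forms.

(** * Rank-one changes and spectral flow *)

Section RankOne.
Context (K : realFieldType) (V : vectType K).
Implicit Types (q : V -> V -> K) (U W : {vspace V}).

(* (W', q') arises from (W, q) either by imposing the condition l = 0 or by
   adding a positive multiple of l^2. *)
Definition rank_one_change q W q' W' := exists l : V -> K,
  [/\ forall a x y, l (a *: x + y) = a * l x + l y &
   ((forall x, x \in W' <-> x \in W /\ l x = 0) /\
     {in W' &, forall x y, q' x y = q x y}) \/
   (W' = W /\ exists2 d, 0 < d &
     {in W &, forall x y, q' x y = q x y + d * (l x * l y)})].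

Section Change.
Context q W q' W' (ch : rank_one_change q W q' W').

(** In both cases [W'] lies in [W] and [q <= q'] on the diagonal of [W']. *)
Lemma change_index_le n : index_ge q' W' n -> index_ge q W n.
Proof.
move=> [U [UW' dU Un]]; exists U.
case: ch => l [ll [[W'W q'q]|[W'W [d d0 q'q]]]].
  split=> //; first by apply/subvP => x /(subvP UW')/W'W[].
  by move=> x xU /(Un _ xU); rewrite q'q// (subvP UW').
rewrite W'W in UW'; split=> // x xU /(Un _ xU).
rewrite q'q ?(subvP UW')// => h; apply: le_lt_trans h.
by rewrite lerDl pmulr_rge0// -expr2 sqr_ge0.
Qed.

(** The two forms agree on the kernel of [l], and intersecting with that kernel costs at most one
    dimension. *)
Lemma change_index_ge n : index_ge q W n.+1 -> index_ge q' W' n.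
Proof.
move=> [U [UW dU Un]]; case: ch => l [ll h].
have [U' U'P dU'] := @dim_common_kernel _ V 1 (fun _ => l) U (fun _ => ll).
apply: (@index_geW _ _ _ _ (\dim U')); first by rewrite dU addn1 in dU'.
have U'U x : x \in U' -> x \in U by move=> /U'P[].
have l0 x : x \in U' -> l x = 0 by move=> /U'P[_ /(_ ord0)].
exists U'; case: h => [[W'W q'q]|[W'W [d d0 q'q]]].
  have U'W' x : x \in U' -> x \in W'.
    by move=> xU'; apply/W'W; split; [exact/(subvP UW)/U'U|exact: l0].
  split=> //; first by apply/subvP.
  by move=> x xU' x0; rewrite q'q ?U'W'//; apply: Un => //; exact: U'U.
rewrite W'W; split=> //; first by apply/subvP => x /U'U/(subvP UW).
move=> x xU' x0; have xW := subvP UW _ (U'U _ xU').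
by rewrite q'q// l0// !mulr0 addr0; apply: Un => //; exact: U'U.
Qed.

Context (qs : symform q) (qs' : symform q').
Let Z := radical W qs.
Let Z' := radical W' qs'.

(** The intersection of [Z] and [Z'] contains the kernel of [l] on [Z] and has codimension at most 1
    in each of them. Moreover one radical contains the other, so the intersection is the smaller
    one: if [l] vanishes on [Z] then [Z] lies in [Z'], and otherwise [Z'] lies in [Z]. *)
Lemma change_radical : [/\ (\dim Z <= \dim Z' + 1)%N, (\dim Z' <= \dim Z + 1)%N &
  \dim (Z :&: Z') = minn (\dim Z) (\dim Z')].
Proof.
have dS : (\dim (Z :&: Z') <= \dim Z)%N := dimvS (capvSl _ _).
have dS' : (\dim (Z :&: Z') <= \dim Z')%N := dimvS (capvSr _ _).
case: ch => l [ll h].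
have [Y YP dY] := @dim_common_kernel _ V 1 (fun _ => l) Z (fun _ => ll).
have YS : (Y <= Z :&: Z')%VS.
  apply/subvP => x /YP[xZ /(_ ord0) lx]; rewrite memv_cap xZ.
  have /(radicalP W qs)[xW qx] := xZ.
  apply/(radicalP W' qs'); case: h => [[W'W q'q]|[W'W [d d0 q'q]]].
    have xW' : x \in W' by apply/W'W.
    by split=> // y yW'; rewrite q'q//; apply: qx; case: ((W'W y).1 yW').
  by rewrite W'W; split=> // y yW; rewrite q'q// lx mul0r mulr0 addr0 qx.
have dYS := dimvS YS.
have h1 : (\dim Z' <= \dim (Z :&: Z') + 1)%N.
  case: h => [[W'W q'q]|[W'W [d d0 q'q]]].
    (* If [l] vanishes on [W] nothing has changed. Otherwise [W] is spanned by [W'] and [w], so a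
       vector of [Z'] is in [Z] once it is q-orthogonal to [w]. *)
    have [[w wW lw]|nW] := pselect (exists2 w, w \in W & l w != 0); last first.
      suff -> : (Z :&: Z')%VS = Z' by rewrite leq_addr.
      apply/capv_idPr/subvP => x /(radicalP W' qs')[/W'W[xW lx] qx].
      apply/(radicalP W qs); split=> // y yW.
      have yW' : y \in W'.
        by apply/W'W; split=> //; apply/eqP/negPn/negP => ly; apply: nW; exists y.
      by rewrite -q'q ?qx//; apply/W'W.
    have [X XP dX] := @dim_common_kernel _ V 1 (fun _ x => q x w) Z'
      (fun _ a x y => form_lin qs a x y w).
    rewrite (leq_trans dX)// leq_add2r dimvS//; apply/subvP => x /XP[xZ' /(_ ord0) qxw].
    rewrite memv_cap xZ' andbT.
    have /(radicalP W' qs')[/[dup] xW' /W'W[xW lx] qx] := xZ'.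
    apply/(radicalP W qs); split=> // y yW.
    have yW' : (- (l y / l w)) *: w + y \in W'.
      apply/W'W; split; first by rewrite memvD// memvZ.
      by rewrite ll mulNr divfK// addNr.
    by have := qx _ yW'; rewrite q'q// form_linr// qxw mulr0 add0r.
  have [X XP dX] := @dim_common_kernel _ V 1 (fun _ => l) Z' (fun _ => ll).
  rewrite (leq_trans dX)// leq_add2r dimvS//; apply/subvP => x /XP[xZ' /(_ ord0) lx].
  rewrite memv_cap xZ' andbT; have /(radicalP W' qs')[xW qx] := xZ'.
  rewrite W'W in xW qx; apply/(radicalP W qs); split=> // y yW.
  by have := qx y yW; rewrite q'q// lx mul0r mulr0 addr0.
split; [lia|lia|].
have [[w wZ lw]|nZ] := pselect (exists2 w, w \in Z & l w != 0); last first.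
  have ZZ' : (Z <= Z')%VS.
    apply/subvP => x xZ; have xY : x \in Y.
      by apply/YP; split=> // _; apply/eqP/negPn/negP => lx; apply: nZ; exists x.
    by move: (subvP YS _ xY); rewrite memv_cap => /andP[].
  by rewrite (minn_idPl (dimvS ZZ')); congr (\dim _); exact/capv_idPl.
suff Z'Z : (Z' <= Z)%VS by rewrite (minn_idPr (dimvS Z'Z)); congr (\dim _); exact/capv_idPr.
(* For a restricted form, [w] is itself q-orthogonal to everything, so testing against [W']
   suffices. For an added square, testing [x] of [Z'] against [w] leaves [d * (l x * l w) = 0], so
   [l x = 0]. *)
have /(radicalP W qs)[wW qw] := wZ.
apply/subvP => x /(radicalP W' qs')[xW' qx].
case: h => [[W'W q'q]|[W'W [d d0 q'q]]].
  have /W'W[xW lx] := xW'; apply/(radicalP W qs); split=> // y yW.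
  have yW' : (- (l y / l w)) *: w + y \in W'.
    apply/W'W; split; first by rewrite memvD// memvZ.
    by rewrite ll mulNr divfK// addNr.
  by have := qx _ yW'; rewrite q'q// form_linr// [q x w]formC// qw// mulr0 add0r.
rewrite W'W in xW' qx; have lx : l x = 0.
  have := qx w wW; rewrite q'q// (formC qs x) qw// add0r => /eqP.
  by rewrite !mulf_eq0 (gt_eqF d0) (negbTE lw) orbF => /eqP.
apply/(radicalP W qs); split=> // y yW.
by have := qx y yW; rewrite q'q// lx mul0r mulr0 addr0.
Qed.

End Change.
End RankOne.

(** * Stability of positive definiteness under small perturbations *)

Section Perturbation.
Context (R : realType) (V : vectType R).
Implicit Types (U W : {vspace V}).

(* Expanding in the basis dual for q to a basis of U, Cauchy-Schwarz bounds the
   coordinates of x by a multiple of q(x, x). *)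
Lemma pos_on_coercive (q : V -> V -> R) U : symform q -> pos_on q U ->
  exists2 C, 0 < C & forall x, x \in U ->
    \sum_(i < \dim U) coord (vbasis U) i x ^+ 2 <= C * q x x.
Proof.
move=> qs Up; pose b (i : 'I_(\dim U)) := (vbasis U)`_i.
have bU i : b i \in U by rewrite vbasis_mem// mem_nth// size_tuple.
have Up0 x : x \in U -> 0 <= q x x.
  by have [->|x0 xU] := eqVneq x 0; [rewrite form0l|rewrite ltW// Up].
pose g := \matrix_(i, j) q (b i) (b j).
have gu : g \in unitmx.
  rewrite -row_free_unit; apply: inj_row_free => v vg.
  pose x := \sum_i v 0 i *: b i.
  have xU : x \in U by rewrite memv_suml// => i _; rewrite memvZ.
  have qx j : q x (b j) = 0.
    have /rowP/(_ j) := vg; rewrite !mxE => <-.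
    by rewrite form_suml//; apply: eq_bigr => i _; rewrite formZl// mxE.
  have x0 : x = 0.
    apply/eqP/negPn/negP => /(Up _ xU); rewrite {2}/x form_sumr// big1 ?ltxx// => i _.
    by rewrite formZr// qx mulr0.
  apply/rowP => i; rewrite mxE.
  have /basis_free/freeP : basis_of U (vbasis U) by exact: vbasisP.
  by move=> /(_ (fun i => v 0 i) x0).
pose w i := \sum_j (invmx g) i j *: b j.
have wU i : w i \in U by rewrite memv_suml// => j _; rewrite memvZ.
have qw i k : q (w i) (b k) = (i == k)%:R.
  have /matrixP/(_ i k) := mulVmx gu; rewrite !mxE => <-.
  by rewrite form_suml//; apply: eq_bigr => j _; rewrite formZl// mxE.
(* The 1 keeps the constant positive when [U] is 0. *)
exists (1 + \sum_i q (w i) (w i)).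
  by rewrite ltr_pwDl// sumr_ge0// => i _; exact: Up0.
move=> x xU; rewrite mulrDl mul1r ler_wpDl ?Up0// mulr_suml ler_sum// => i _.
have -> : coord (vbasis U) i x = q (w i) x.
  rewrite [X in q _ X](coord_vbasis xU) form_sumr// (bigD1 i)//= big1 ?addr0.
    by rewrite formZr// qw eqxx mulr1.
  by move=> j ji; rewrite formZr// qw eq_sym (negbTE ji) mulr0.
exact: psd_cauchy_schwarz Up0 _ xU.
Qed.

Context (q : R -> V -> V -> R) (qs : forall t, symform (q t)) (T : R).
Hypothesis q_cont : forall t0 x y (e : R), t0 <= T -> 0 < e ->
  \forall t \near t0, t <= T -> `|q t x y - q t0 x y| < e.

Lemma pos_on_near U t0 : t0 <= T -> pos_on (q t0) U ->
  \forall t \near t0, t <= T -> pos_on (q t) U.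
Proof.
move=> t0T Up; have [C C0 UC] := pos_on_coercive (qs t0) Up.
pose n := \dim U; pose b (i : 'I_n) := (vbasis U)`_i.
(* By coercivity each of the [n * n] products of coordinates of [x] is at most [C * q t0 x x].
   Entrywise changes below [e] thus move [q x x] by less than [q t0 x x]; the successor makes this
   strict. *)
pose e := (C * (n * n).+1%:R)^-1.
have e0 : 0 < e by rewrite invr_gt0 mulr_gt0.
have nearij : \forall t \near t0, forall ij : 'I_n * 'I_n,
    t <= T -> `|q t (b ij.1) (b ij.2) - q t0 (b ij.1) (b ij.2)| < e.
  have h := @filter_forall _ _ (fun (ij : 'I_n * 'I_n) t =>
    t <= T -> `|q t (b ij.1) (b ij.2) - q t0 (b ij.1) (b ij.2)| < e) (nbhs t0) _.
  by apply: h => ij; exact: q_cont.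
apply: filterS nearij => t te tT x xU x0.
pose c i := coord (vbasis U) i x.
have xE : x = \sum_i c i *: b i := coord_vbasis xU.
have qE s : q s x x = \sum_i \sum_j c i * c j * q s (b i) (b j).
  rewrite {1}xE form_suml//; apply: eq_bigr => i _; rewrite formZl// xE form_sumr//.
  by rewrite mulr_sumr; apply: eq_bigr => j _; rewrite formZr// mulrA.
have qx := Up _ xU x0.
suff : `|q t x x - q t0 x x| < q t0 x x by rewrite ltr_norml => /andP[]; lra.
have -> : q t x x - q t0 x x =
    \sum_i \sum_j c i * c j * (q t (b i) (b j) - q t0 (b i) (b j)).
  rewrite !qE -sumrB; apply: eq_bigr => i _; rewrite -sumrB.
  by apply: eq_bigr => j _; rewrite mulrBr.
have cc i j : `|c i * c j| <= C * q t0 x x.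
  apply: le_trans (UC _ xU); rewrite -/n.
  have ck k : c k ^+ 2 <= \sum_i c i ^+ 2.
    by rewrite (bigD1 k)//= lerDl sumr_ge0// => l _; exact: sqr_ge0.
  have : `|c i * c j| <= (c i ^+ 2 + c j ^+ 2) / 2.
    have : 0 <= (`|c i| - `|c j|) ^+ 2 by exact: sqr_ge0.
    rewrite -[c i ^+ 2]real_normK ?num_real// -[c j ^+ 2]real_normK ?num_real//.
    by rewrite normrM; nra.
  by have := ck i; have := ck j; lra.
apply: (@le_lt_trans _ _ (\sum_(i < n) \sum_(j < n) (C * q t0 x x * e))).
  apply: le_trans (ler_norm_sum _ _ _) _; apply: ler_sum => i _.
  apply: le_trans (ler_norm_sum _ _ _) _; apply: ler_sum => j _.
  by rewrite normrM ler_pM// ltW// (te (i, j)).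
rewrite !sumr_const !card_ord -mulrnA -[X in X < _]mulr_natr /e.
have -> : C * q t0 x x * (C * (n * n).+1%:R)^-1 * (n * n)%:R =
    q t0 x x * ((n * n)%:R / (n * n).+1%:R) by field; rewrite gt_eqF//= gt_eqF.
by rewrite gtr_pMr// ltr_pdivrMr// mul1r ltr_nat.
Qed.

End Perturbation.

Section Flow.
Context (R : realType) (V : vectType R).
Context (q : R -> V -> V -> R) (qs : forall t, symform (q t)) (T : R).
Hypothesis q_cont : forall t0 x y (e : R), t0 <= T -> 0 < e ->
  \forall t \near t0, t <= T -> `|q t x y - q t0 x y| < e.
Context (W : {vspace V}).
Hypothesis q_decr : forall t t' x, t < t' -> t' <= T -> x \in W -> x != 0 ->
  q t' x x < q t x x.
Hypothesis q_low : exists t0, forall t, t <= t0 -> pos_on (q t) W.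
Context (lam : nat -> R).
Hypothesis lam_mono : forall k, lam k <= lam k.+1.
Hypothesis lam_card : forall t, t <= T ->
  ([set k | lam k = t] #= `I_(\dim (radical W (qs t))))%card.

Let lam_homo i j : (i <= j)%N -> lam i <= lam j.
Proof.
elim: j => [|j IH]; first by rewrite leqn0 => /eqP->.
by rewrite leq_eqVlt => /predU1P[->//|/IH/le_trans]; apply.
Qed.

(** Let [i] be the first index with [lam i = lam k]. By induction the index at the parameter [lam k]
    is at least [i], and passing it adds the dimension of the radical, which is at least [k + 1 - i]
    because the indices from [i] to [k] share one level set. *)
Lemma index_ge_of_lam k t : t <= T -> lam k < t -> index_ge (q t) W k.+1.
Proof.
elim/ltn_ind: k t => k IH t tT kt.
have ex : exists j, lam j == lam k by exists k.
case: (ex_minnP ex) => i /eqP ik imin.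
have ik' : (i <= k)%N by apply: imin.
have LT : lam k <= T by rewrite ltW// (lt_le_trans kt).
have Hi : index_ge (q (lam k)) W i.
  case: i ik imin ik' => [|i] ik imin ik'; first exact: index_ge0.
  apply: IH => //; rewrite lt_neqAle lam_homo ?andbT; last exact: ltnW.
  by apply/negP => /imin; rewrite ltnn.
have := index_ge_radical (qs (lam k)) (qs t) (fun x => q_decr kt tT) Hi.
apply: index_geW; have := lam_card LT.
set m := \dim _ => Em; suff : (k.+1 - i <= m)%N by lia.
rewrite -card_le_II -(card_le_eqr Em).
have inj : {in `I_(k.+1 - i) &, injective (addn i)} by move=> x y _ _ /addnI.
rewrite -(card_le_eql (inj_card_eq inj)).
have le1 : ([set addn i j | j in `I_(k.+1 - i)] #<= [set j | lam j = lam k])%card.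
  apply: subset_card_le => _ /= [j jk <-]; apply/eqP; rewrite eq_le.
  by rewrite -{2}ik !lam_homo//=; lia.
apply: card_le_trans le1.
by have := inj_card_eq inj; rewrite card_eq_le => /andP[].
Qed.

(** If [lam k > t], the whole level set of [t] lies between [i] and [k - 1] and is too small. *)
Lemma lam_le_of_lt t i k : t <= T -> (forall j, (j < i)%N -> lam j < t) ->
  (k < i + \dim (radical W (qs t)))%N -> lam k <= t.
Proof.
move=> tT it; set m := \dim _ => km; rewrite leNgt; apply/negP => tk.
suff : (m <= k - i)%N.
  have [ik|ki] := leqP i k; first by lia.
  by have := it _ ki; lra.
rewrite -card_le_II -(card_le_eql (lam_card tT)).
apply: card_le_trans (card_image_le (addn i) _); apply: subset_card_le => j /= jt.
have ij : (i <= j)%N by rewrite leqNgt; apply/negP => /it; rewrite jt ltxx.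
have jk : (j < k)%N by rewrite ltnNge; apply/negP => /lam_homo; rewrite jt leNgt tk.
by exists (j - i)%N => /=; lia.
Qed.

(* At the infimum L of the bad parameters, either L is bad and a negative
   subspace for L is still negative just below L, or L is good and just above L
   the index is at most index(L) + dim radical(L), which lam accounts for. *)
Lemma lam_lt_of_index_ge k t : t <= T -> index_ge (q t) W k.+1 -> lam k < t.
Proof.
move=> tT kt; rewrite ltNge; apply/negP => tk.
pose B : set R := [set s | s <= T /\ exists2 j, index_ge (q s) W j.+1 & s <= lam j]%classic.
have B0 : (B !=set0)%classic by exists t; split=> //; exists k.
have [t0 t0W] := q_low.
have Bt0 : lbound B t0.
  move=> s [sT [j [U [UW dU Un]] _]]; rewrite leNgt; apply/negP => /ltW/t0W Wp.
  have U0 : U != 0%VS by rewrite -dimv_eq0 dU.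
  have xU := memv_pick U; move: U0; rewrite -vpick0 => x0.
  by have := Un _ xU x0; have := Wp _ (subvP UW _ xU) x0; lra.
set L := inf B.
have LB s : B s -> L <= s by move=> Bs; apply: ge_inf => //; exists t0.
have LT : L <= T by apply: le_trans (tT); apply: LB; split=> //; exists k.
have goodL (s : R) : s < L -> forall j, index_ge (q s) W j.+1 -> lam j < s.
  move=> sL j js; rewrite ltNge; apply/negP => sj; move: (sL); rewrite ltNge LB//.
  by split; [exact: ltW (lt_le_trans sL LT)|exists j].
have [[_ [j [U [UW dU Un]] Lj]]|nBL] := pselect (B L).
  (* Stability is available for positive forms, so it is applied to [- q]. *)
  pose nq s x y := - q s x y.
  have nqs s : symform (nq s).
    by split=> [a x y z|x y]; rewrite /nq; [rewrite (form_lin (qs s)); ring|rewrite (formC (qs s))].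
  have ncont (s : R) x y (e : R) : s <= T -> 0 < e ->
      \forall t \near s, t <= T -> `|nq t x y - nq s x y| < e.
    move=> sT e0; apply: filterS (q_cont x y sT e0) => r h rT.
    by rewrite /nq -opprD normrN; exact: h.
  have Up : pos_on (nq L) U by move=> x xU x0; rewrite oppr_gt0; exact: Un.
  have /nbhs_ballP[e /= e0 He] := pos_on_near nqs ncont LT Up.
  have eL : L - e / 2 < L by rewrite ltrBlDr ltrDl divr_gt0.
  have : lam j < L - e / 2.
    apply: goodL => //; exists U; split=> // x xU x0; rewrite -oppr_gt0.
    apply: (He (L - e / 2)) => //; last by rewrite (le_trans (ltW eL)).
    by rewrite /ball /= subKr gtr0_norm ?divr_gt0// ltr_pdivrMr// ltr_pMr// ltr1n.
  by move=> h; have := lt_trans h eL; rewrite ltNge Lj.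
have [i [U [iL UW Up dW]]] := sylvester W (qs L).
have /nbhs_ballP[e /= e0 He] := pos_on_near qs q_cont LT Up.
have [s [sT [j js sj]] se] := inf_adherent e0 (conj B0 (ex_intro _ t0 Bt0)).
rewrite -/L in se.
have Ls : L < s.
  rewrite lt_neqAle LB ?andbT; last by split=> //; exists j.
  by apply/eqP => Ls; apply: nBL; rewrite Ls; split=> //; exists j.
have Us : pos_on (q s) U.
  by apply: He => //; rewrite /ball /= ler0_norm ?subr_le0 ?ltW// opprB ltrBlDl.
have := index_ge_codim js Us UW => jd.
suff : lam j <= L by move=> h; have := le_lt_trans h Ls; rewrite ltNge sj.
apply: (@lam_le_of_lt L i j) => //; last by lia.
move=> l li; rewrite ltNge; apply/negP => Ll; apply: nBL; split=> //; exists l => //.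
exact: index_geW iL.
Qed.
End Flow.

(** * Solutions of u'' = - L u *)

Section Solutions.
Context (R : realType).
Implicit Types (L x : R).

(* The solutions of u'' = - L u with (u, u')(0) = (1, 0) and (0, 1). *)
Definition csol L x : R :=
  if 0 < L then cos (Num.sqrt L * x)
  else (expR (Num.sqrt (- L) * x) + expR (- (Num.sqrt (- L) * x))) / 2.

Definition ssol L x : R :=
  if 0 < L then sin (Num.sqrt L * x) / Num.sqrt L
  else if L == 0 then x
  else (expR (Num.sqrt (- L) * x) - expR (- (Num.sqrt (- L) * x))) / (2 * Num.sqrt (- L)).

Lemma csol0 L : csol L 0 = 1.
Proof. by rewrite /csol !mulr0 cos0 oppr0 expR0; case: ifP => // _; field. Qed.

Lemma ssol0 L : ssol L 0 = 0.
Proof. by rewrite /ssol !mulr0 sin0 oppr0 expR0 subrr !mul0r; do !case: ifP. Qed.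

Lemma is_derive_csol L x : is_derive x 1 (csol L) (- L * ssol L x).
Proof.
rewrite /csol /ssol; case: ltP => [L0|L0].
  have r0 : Num.sqrt L != 0 by rewrite gt_eqF// sqrtr_gt0.
  apply: is_derive_eq; rewrite ?/GRing.scale /=.
  have LE : L = Num.sqrt L ^+ 2 by rewrite sqr_sqrtr// ltW.
  by set r := Num.sqrt L in LE r0 *; rewrite LE; field.
apply: is_derive_eq; rewrite ?/GRing.scale /=.
have [->|Ln0] := eqVneq L 0; first by rewrite oppr0 sqrtr0; field.
have r0 : Num.sqrt (- L) != 0 by rewrite gt_eqF// sqrtr_gt0 oppr_gt0 lt_neqAle Ln0.
have LE : - L = Num.sqrt (- L) ^+ 2 by rewrite sqr_sqrtr// oppr_ge0.
set r := Num.sqrt (- L) in LE r0 *; rewrite LE; field.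
by [].
Qed.

Lemma is_derive_ssol L x : is_derive x 1 (ssol L) (csol L x).
Proof.
rewrite /csol /ssol; case: ltP => [L0|L0].
  have r0 : Num.sqrt L != 0 by rewrite gt_eqF// sqrtr_gt0.
  by apply: is_derive_eq; rewrite ?/GRing.scale /=; field.
have [->|Ln0] := eqVneq L 0.
  by apply: is_derive_eq; rewrite oppr0 sqrtr0 !mul0r oppr0 expR0; field.
have r0 : Num.sqrt (- L) != 0 by rewrite gt_eqF// sqrtr_gt0 oppr_gt0 lt_neqAle Ln0.
by apply: is_derive_eq; rewrite ?/GRing.scale /=; field.
Qed.

Lemma csolD L x y : csol L (x + y) = csol L x * csol L y - L * (ssol L x * ssol L y).
Proof.
rewrite /csol /ssol; case: ltP => [L0|L0].
  have r0 : Num.sqrt L != 0 by rewrite gt_eqF// sqrtr_gt0.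
  have LE : L = Num.sqrt L ^+ 2 by rewrite sqr_sqrtr// ltW.
  by set r := Num.sqrt L in LE r0 *; rewrite LE mulrDr cosD; field.
have [->|Ln0] := eqVneq L 0.
  by rewrite oppr0 sqrtr0 !mul0r oppr0 expR0; field.
have r0 : Num.sqrt (- L) != 0 by rewrite gt_eqF// sqrtr_gt0 oppr_gt0 lt_neqAle Ln0.
have LE : L = - Num.sqrt (- L) ^+ 2 by rewrite sqr_sqrtr ?opprK// oppr_ge0.
set r := Num.sqrt (- L) in LE r0 *; rewrite LE mulrDr opprD !expRD.
by field.
Qed.

Lemma ssolD L x y : ssol L (x + y) = ssol L x * csol L y + csol L x * ssol L y.
Proof.
rewrite /csol /ssol; case: ltP => [L0|L0].
  have r0 : Num.sqrt L != 0 by rewrite gt_eqF// sqrtr_gt0.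
  by rewrite mulrDr sinD; field.
have [->|Ln0] := eqVneq L 0.
  by rewrite oppr0 sqrtr0 !mul0r oppr0 expR0; field.
have r0 : Num.sqrt (- L) != 0 by rewrite gt_eqF// sqrtr_gt0 oppr_gt0 lt_neqAle Ln0.
by rewrite mulrDr opprD !expRD; field.
Qed.

(** The conserved energy of [ssol], which is also the determinant of the fundamental matrix. *)
Lemma csol_ssol_sqr L x : csol L x ^+ 2 + L * ssol L x ^+ 2 = 1.
Proof.
have := @is_derive_0_is_cst R (fun x => csol L x ^+ 2 + L * ssol L x ^+ 2) x 0.
rewrite csol0 ssol0 expr0n mulr0 addr0 expr1n; apply=> y.
have dc := is_derive_csol L y; have ds := is_derive_ssol L y.
by apply: is_derive_eq; rewrite /GRing.scale /=; ring.
Qed.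

Lemma csol_gt0 L x : 0 <= x -> L * x ^+ 2 < 1 -> 0 < csol L x.
Proof.
move=> x0 Lx; rewrite /csol; case: (ltP 0 L) => L0; last by rewrite divr_gt0// addr_gt0// expR_gt0.
have r0 : 0 <= Num.sqrt L * x by rewrite mulr_ge0// sqrtr_ge0.
have r1 : Num.sqrt L * x < 1.
  by rewrite -(@ltr_pXn2r _ 2)// ?nnegrE// expr1n exprMn sqr_sqrtr// ltW.
by apply: cos_gt0_pihalf; have := pihalf_ge1 R; lra.
Qed.

Lemma ssol_gt0 L x : 0 < x -> L * x ^+ 2 < 1 -> 0 < ssol L x.
Proof.
move=> x0 Lx; rewrite /ssol; case: (ltP 0 L) => L0.
  have r0 : 0 < Num.sqrt L * x by rewrite mulr_gt0// sqrtr_gt0.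
  have r1 : Num.sqrt L * x < 1.
    by rewrite -(@ltr_pXn2r _ 2)// ?nnegrE ?ltW// expr1n exprMn sqr_sqrtr// ltW.
  rewrite divr_gt0 ?sqrtr_gt0// sin_gt0_pi// r0.
  by have := pihalf_ge1 R; lra.
have [//|Ln0] := eqVneq L 0.
have r0 : 0 < Num.sqrt (- L) by rewrite sqrtr_gt0 oppr_gt0 lt_neqAle Ln0.
rewrite divr_gt0 ?mulr_gt0// subr_gt0 ltr_expR.
by have := mulr_gt0 r0 x0; lra.
Qed.

(** * Dirichlet-to-Neumann coefficients of a segment *)

Section Slopes.
Context (h : R) (h0 : 0 < h).

(* The derivative at h of the odd, resp. even, solution with value 1 at h. *)
Definition oddslope L : R := csol L h / ssol L h.
Definition evenslope L : R := - L * ssol L h / csol L h.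

(** Any bound up to [(pi / 2) ^ 2] would keep [csol L] and [ssol L] positive on []0, h]]; 1 is a
    convenient one. Negative [L] always qualify. *)
Definition admissible L := L * h ^+ 2 < 1.

Lemma admissible_le L M : L <= M -> admissible M -> admissible L.
Proof. by move=> LM; apply: le_lt_trans; rewrite ler_wpM2r// sqr_ge0. Qed.

Lemma admissible_sub L x : admissible L -> 0 <= x -> x <= h -> L * x ^+ 2 < 1.
Proof.
move=> LA x0 xh; have [L0|L0] := leP L 0.
  by rewrite (le_lt_trans _ (@ltr01 R))// mulr_le0_ge0// sqr_ge0.
by apply: le_lt_trans LA; rewrite ler_pM2l// ler_pXn2r// nnegrE// ltW.
Qed.

Lemma csolh_gt0 L : admissible L -> 0 < csol L h.
Proof. by apply: csol_gt0; exact: ltW. Qed.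

Lemma ssolh_gt0 L : admissible L -> 0 < ssol L h.
Proof. exact: ssol_gt0. Qed.

Lemma oddslope_gt0 L : admissible L -> 0 < oddslope L.
Proof. by move=> LA; rewrite divr_gt0 ?csolh_gt0 ?ssolh_gt0. Qed.

Lemma evenslopeE L : admissible L -> evenslope L = - L / oddslope L.
Proof.
by move=> LA; rewrite /evenslope /oddslope; field; rewrite !gt_eqF ?csolh_gt0 ?ssolh_gt0.
Qed.

Lemma ssol_homo L x : admissible L -> 0 <= x -> x <= h -> ssol L x <= ssol L h.
Proof.
move=> LA x0; rewrite le_eqVlt => /predU1P[->//|xh].
have ds (y : R) : is_derive y 1 (ssol L) (csol L y) := is_derive_ssol L y.
have [] := @MVT R (ssol L) (csol L) x h xh (fun y _ => ds y).
  by apply: derivable_within_continuous => y _; exact: (@ex_derive _ _ _ _ _ _ _ (ds y)).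
move=> c /[!in_itv] /= /andP[xc ch] E; rewrite -subr_ge0 E mulr_ge0 ?subr_ge0 ?(ltW xh)//.
have c0 : 0 <= c by lra.
by rewrite ltW// csol_gt0// admissible_sub// ltW.
Qed.

(* The Wronskian of the solutions for L and M has derivative (L - M) times
   their product. *)
Lemma oddslope_diff L M : L < M -> admissible M ->
  0 < oddslope L - oddslope M <= h * (M - L).
Proof.
move=> LM MA; have LA := admissible_le (ltW LM) MA.
pose W x := ssol L x * csol M x - csol L x * ssol M x.
have dW (y : R) : is_derive y 1 W ((L - M) * (ssol L y * ssol M y)).
  have d1 := is_derive_csol L y; have d2 := is_derive_ssol L y.
  have d3 := is_derive_csol M y; have d4 := is_derive_ssol M y.
  by apply: is_derive_eq; rewrite /GRing.scale /=; ring.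
have [] := @MVT R W _ 0 h h0 (fun y _ => dW y).
  by apply: derivable_within_continuous => y _; exact: (@ex_derive _ _ _ _ _ _ _ (dW y)).
move=> c /[!in_itv] /= /andP[c0 ch].
rewrite {2}/W !ssol0 mul0r mulr0 !subr0 => E.
have sL0 := ssolh_gt0 LA; have sM0 := ssolh_gt0 MA.
have -> : oddslope L - oddslope M = - W h / (ssol L h * ssol M h).
  by rewrite /oddslope /W; field; rewrite !gt_eqF.
have scL : 0 < ssol L c by rewrite ssol_gt0// admissible_sub// ltW.
have scM : 0 < ssol M c by rewrite ssol_gt0// admissible_sub// ltW.
have -> : - W h = h * (M - L) * (ssol L c * ssol M c) by rewrite E; ring.
have hML : 0 < h * (M - L) by rewrite mulr_gt0// subr_gt0.
apply/andP; split; first by rewrite divr_gt0// mulr_gt0// mulr_gt0.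
rewrite ler_pdivrMr ?mulr_gt0// ler_pM2l//.
by apply: ler_pM; try apply: ssol_homo; rewrite // ltW.
Qed.

Lemma oddslope_decr L M : L < M -> admissible M -> oddslope M < oddslope L.
Proof. by move=> LM /(oddslope_diff LM)/andP[]; rewrite subr_gt0. Qed.

Lemma evenslope_decr L M : L < M -> admissible M -> evenslope M < evenslope L.
Proof.
move=> LM MA; have LA := admissible_le (ltW LM) MA.
(* Minus the Wronskian of the even solutions [csol L] and [csol M]. *)
pose W x := L * (ssol L x * csol M x) - M * (csol L x * ssol M x).
have dW (y : R) : is_derive y 1 W ((L - M) * (csol L y * csol M y)).
  have d1 := is_derive_csol L y; have d2 := is_derive_ssol L y.
  have d3 := is_derive_csol M y; have d4 := is_derive_ssol M y.
  by apply: is_derive_eq; rewrite /GRing.scale /=; ring.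
have [] := @MVT R W _ 0 h h0 (fun y _ => dW y).
  by apply: derivable_within_continuous => y _; exact: (@ex_derive _ _ _ _ _ _ _ (dW y)).
move=> c /[!in_itv] /= /andP[c0 ch].
rewrite {2}/W !ssol0 mul0r !mulr0 !subr0 => E.
have cL0 := csolh_gt0 LA; have cM0 := csolh_gt0 MA.
rewrite -subr_gt0.
have -> : evenslope L - evenslope M = - W h / (csol L h * csol M h).
  by rewrite /evenslope /W; field; rewrite !gt_eqF.
rewrite divr_gt0 ?mulr_gt0// E -!mulNr opprB.
rewrite !mulr_gt0 ?subr_gt0// csol_gt0 ?admissible_sub// ltW//.
Qed.

Lemma oddslope_lipschitz L M : admissible L -> admissible M ->
  `|oddslope L - oddslope M| <= h * `|L - M|.
Proof.
move=> LA MA; have [LM|LM|->] := ltgtP L M; last by rewrite !subrr normr0 mulr0.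
  have /andP[d0 dh] := oddslope_diff LM MA.
  by rewrite gtr0_norm// ltr0_norm ?subr_lt0// opprB.
have /andP[d0 dh] := oddslope_diff LM LA.
by rewrite distrC gtr0_norm// gtr0_norm ?subr_gt0.
Qed.

(** With [k = sqrt (- L)] the slope is [k coth (k h)], and the bound amounts to
    [exp (2 k h) >= 1 + 2 k h]. *)
Lemma oddslope_le L : L < 0 -> oddslope L <= Num.sqrt (- L) + h^-1.
Proof.
move=> L0; rewrite /oddslope /csol /ssol ltNge (ltW L0) /= lt_eqF//.
set k := Num.sqrt (- L); have k0 : 0 < k by rewrite sqrtr_gt0 oppr_gt0.
have kh : 0 < k * h by rewrite mulr_gt0.
have E1 := expR_ge1Dx (2 * (k * h)).
have -> : expR (- (k * h)) = expR (k * h) / expR (2 * (k * h)).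
  by rewrite mulr2n mulrDl !mul1r expRD expRN; field; rewrite gt_eqF// expR_gt0.
have := expR_gt0 (k * h); move: E1; set a := expR _; set b := expR _ => E1 b0.
rewrite -subr_ge0.
have -> : k + h^-1 - (b + b / a) / 2 / ((b - b / a) / (2 * k)) =
   (a - 1 - 2 * (k * h)) / (h * (a - 1)).
  by field; rewrite !gt_eqF//; nra.
by apply: divr_ge0; [|apply: mulr_ge0; first exact: ltW]; lra.
Qed.

Lemma evenslope_lt_oddslope L : admissible L -> evenslope L < oddslope L.
Proof.
move=> LA; have c0 := csolh_gt0 LA; have s0 := ssolh_gt0 LA.
rewrite -subr_gt0.
have -> : oddslope L - evenslope L =
    (csol L h ^+ 2 + L * ssol L h ^+ 2) / (ssol L h * csol L h).
  by rewrite /oddslope /evenslope; field; rewrite !gt_eqF.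
by rewrite csol_ssol_sqr divr_gt0// mulr_gt0.
Qed.

Lemma evenslope_low C : exists2 L0, L0 < 0 & forall L, L <= L0 -> C <= evenslope L.
Proof.
(* Since [evenslope] is [k ^ 2 / oddslope] with [k = sqrt (- L)], it suffices that
   [C (k + 1/h) <= k ^ 2]. For [k >= k0] one has [C <= k - 1/h], and the product of [k - 1/h] and
   [k + 1/h] is at most [k ^ 2]. *)
pose k0 := `|C| + h^-1 + 1.
have i0 : 0 < h^-1 by rewrite invr_gt0.
have k00 : 0 < k0 by rewrite /k0; have := normr_ge0 C; lra.
have k020 : 0 < k0 ^+ 2 by rewrite exprn_gt0.
exists (- k0 ^+ 2); first by rewrite oppr_lt0.
move=> L LL0; have Ln : L < 0 by lra.
have LA : admissible L.
  by rewrite /admissible (le_lt_trans _ (@ltr01 R))// mulr_le0_ge0 ?sqr_ge0// ltW.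
have Lk : k0 <= Num.sqrt (- L).
  by rewrite -(ger0_norm (ltW k00)) -sqrtr_sqr ler_wsqrtr//; lra.
rewrite evenslopeE// ler_pdivlMr ?oddslope_gt0//.
have A0 := oddslope_gt0 LA; have Ak := oddslope_le Ln.
have LE : - L = Num.sqrt (- L) ^+ 2 by rewrite sqr_sqrtr//; lra.
rewrite LE {LE}; move: Lk A0 Ak; rewrite /k0.
set k : R := Num.sqrt (- L); set A := oddslope L; set c : R := `|C| => ck A0 Ak.
have Cc : C <= c := ler_norm C; have c0 : 0 <= c := normr_ge0 C.
have CA : C * A <= c * A by rewrite ler_wpM2r// ltW.
have cA : c * A <= c * (k + h^-1) by rewrite ler_wpM2l.
apply: le_trans CA (le_trans cA _).
have ck' : c <= k - h^-1 by lra.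
have : c * (k + h^-1) <= (k - h^-1) * (k + h^-1) by rewrite ler_wpM2r//; lra.
have := sqr_ge0 (h^-1 : R); rewrite !expr2; lra.
Qed.

End Slopes.
End Solutions.

(** * Sobolev functions on an interval *)

Section IntervalSobolev.
Context (R : realType).
Implicit Types (f u : R -> R) (l x : R).
Local Notation mu := (@lebesgue_measure R).
Local Open Scope classical_set_scope.

Lemma continuous_is_L2 l f : {within `[0, l], continuous f} -> is_L2 l f.
Proof.
move=> cf; rewrite /is_L2.
have ci : mu.-integrable `[0, l] (EFin \o f).
  by apply: continuous_compact_integrable => //; exact: segment_compact.
have ci2 : mu.-integrable `[0, l] (EFin \o (fun x => f x * f x)).
  apply: continuous_compact_integrable; first exact: segment_compact.
  by move=> x; apply: continuousM; exact: cf.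
have mf : measurable_fun setT (f \_ `[0, l]).
  apply/(measurable_restrictT _ _).1 => //; apply/measurable_EFinP.
  exact: measurable_int ci.
rewrite inE; apply/andP; split; rewrite inE//=.
rewrite /finite_norm unlock poweR_lty//.
have /integrableP[_] := ci2; rewrite [X in (X < _)%E -> _]integral_mkcond; apply: le_lt_trans.
rewrite le_eqVlt; apply/orP; left; apply/eqP; apply: eq_integral => x _ /=.
rewrite !patchE; case: ifP => _ /=; last by rewrite normr0 powR0.
by rewrite powR_mulrn// expr2 normrM.
Qed.

Lemma is_L2_integrable l f : is_L2 l f -> mu.-integrable `[0, l] (EFin \o f).
Proof.
move=> fL2; have oneL2 : is_L2 l (cst 1).
  by apply: continuous_is_L2; apply: continuous_subspaceT => x; exact: cst_continuous.
have /Lfun1_integrable := Lfun2_mul_Lfun1 fL2 oneL2.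
move=> h; apply: (integrable_mkcond _ _).2 => //.
apply: eq_integrable h => // x _ /=.
by rewrite !patchE; case: ifP => _; rewrite /= ?mulr1 ?mulr0.
Qed.

Lemma is_H1_continuous l f f1 : 0 < l -> is_H1 l f f1 -> {within `[0, l], continuous f}.
Proof.
move=> l0 [/is_L2_integrable f1i fE].
have := parameterized_integral_continuous (ltW l0) f1i => cF.
have : {within `[0, l], continuous (fun x => f 0 + (\int[mu]_(t in `[0, x]) f1 t)%R)}.
  by move=> x; apply: cvgD; [exact: cvg_cst|exact: cF].
by apply: subspace_eq_continuous => x; rewrite inE => /fE/esym.
Qed.

Lemma is_derive_integral l f f1 x :
  mu.-integrable `[0, l] (EFin \o f1) -> {within `[0, l], continuous f1} ->
  (forall x, x \in `[0, l]%R -> f x = f 0 + (\int[mu]_(t in `[0, x]) f1 t)%R) ->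
  x \in `]0, l[%R -> is_derive x 1 f (f1 x).
Proof.
move=> f1i f1c fE /[dup] xl; rewrite in_itv /= => /andP[x0 xlt].
have f1x : {for x, continuous f1}.
  have l0 := lt_trans x0 xlt.
  by have /(continuous_within_itvP _ l0)[h _ _] := f1c; exact: h.
have [dF F'] := continuous_FTC1_closed xlt f1i x0 f1x.
have dG : is_derive x 1 (fun x => f 0 + (\int[mu]_(t in `[0, x]) f1 t)%R) (f1 x).
  have dF' : is_derive x 1 (fun x => (\int[mu]_(t in `[0, x]) f1 t)%R) (f1 x).
    by rewrite -F' derive1E; exact: derivableP.
  rewrite -[f1 x]add0r; exact: (is_deriveD (is_derive_cst (f 0) x 1) dF').
apply: near_eq_is_derive dG.
near=> y; rewrite -fE// in_itv /=; apply/andP; split; apply: ltW; near: y.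
  exact: lt_nbhsr.
exact: lt_nbhsl.
Unshelve. all: by end_near. Qed.

Lemma is_H1_of_derive l f f1 : 0 < l -> (forall x : R, is_derive x 1 f (f1 x)) ->
  continuous f1 -> is_H1 l f f1.
Proof.
move=> l0 df cf1; split; first by apply: continuous_is_L2; exact: continuous_subspaceT.
move=> x; rewrite in_itv /= => /andP[]; rewrite le_eqVlt => /predU1P[<- _|x0 xl].
  by rewrite set_itv1 Rintegral_set1 addr0.
have cf : continuous f.
  move=> y; apply: differentiable_continuous; apply/derivable1_diffP.
  exact: (@ex_derive _ _ _ _ _ _ _ (df y)).
rewrite /Rintegral (@continuous_FTC2 _ f1 f)//=; first by rewrite addrCA subrr addr0.
- exact: continuous_subspaceT.
- split=> [y _||]; first exact: (@ex_derive _ _ _ _ _ _ _ (df y)).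
    by apply: cvg_at_right_filter; exact: cf.
  by apply: cvg_at_left_filter; exact: cf.
- by move=> y _; rewrite derive1E; exact: derive_val.
Qed.

Lemma is_derive_cst_on l (p : R -> R) x : {within `[0, l], continuous p} ->
  (forall y : R, y \in `]0, l[%R -> is_derive y 1 p 0) -> x \in `[0, l]%R -> p x = p 0.
Proof.
move=> cp dp; rewrite in_itv /= => /andP[]; rewrite le_eqVlt => /predU1P[<-//|x0 xl].
have [||c _] := @MVT R p (fun=> 0) 0 x x0.
- move=> y; rewrite in_itv /= => /andP[y0 yx]; apply: dp.
  by rewrite in_itv /= y0 (lt_le_trans yx).
- apply: continuous_subspaceW cp => y /=; rewrite !in_itv /= => /andP[-> /le_trans->//].
- by rewrite mul0r => /eqP; rewrite subr_eq0 => /eqP.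
Qed.

(* Both components of the fundamental matrix applied backwards to (u, u') have
   zero derivative. *)
Lemma eigenfunction_edge l L u u1 u2 x : 0 < l -> is_H1 l u u1 -> is_H1 l u1 u2 ->
  ae_eq mu `[0, l] u2 (fun x => - L * u x) -> x \in `[0, l]%R ->
  u x = u 0 * csol L x + u1 0 * ssol L x /\
  u1 x = u 0 * (- L * ssol L x) + u1 0 * csol L x.
Proof.
move=> l0 uH u1H u2E xl.
have cu := is_H1_continuous l0 uH; have cu1 := is_H1_continuous l0 u1H.
have cLu : {within `[0, l], continuous (fun x => - L * u x)}.
  by move=> y; apply: cvgM; [exact: cvg_cst|exact: cu].
have iLu : mu.-integrable `[0, l] (EFin \o (fun x => - L * u x)).
  by apply: continuous_compact_integrable => //; exact: segment_compact.
have iu1 : mu.-integrable `[0, l] (EFin \o u1).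
  by apply: continuous_compact_integrable => //; exact: segment_compact.
(* Replacing [u2] under the integral by the continuous function [- L u] makes [u1] differentiable
   inside the interval. *)
have u1E y : y \in `[0, l]%R -> u1 y = u1 0 + (\int[mu]_(t in `[0, y]) (- L * u t))%R.
  move=> yl; have [u2L2 h] := u1H; rewrite h//; congr (_ + fine _).
  have yl' : `[0, y] `<=` `[0, l].
    by move=> z /=; move: yl; rewrite !in_itv /= => /andP[_ yl] /andP[-> /le_trans->].
  have iu2' : mu.-integrable `[0, y] (EFin \o u2).
    by apply: (@integrableS _ _ _ mu `[0, l] `[0, y]) => //; exact: is_L2_integrable.
  have iLu' : mu.-integrable `[0, y] (EFin \o (fun x => - L * u x)).
    by apply: (@integrableS _ _ _ mu `[0, l] `[0, y]).
  apply: ae_eq_integral => //.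
  - by have /integrableP[] := iu2'.
  - by have /integrableP[] := iLu'.
  - by apply: filterS u2E => z zE zy /=; rewrite zE//; exact: yl'.
have du y : y \in `]0, l[%R -> is_derive y 1 u (u1 y).
  by apply: (@is_derive_integral l) => //; case: uH.
have du1 y : y \in `]0, l[%R -> is_derive y 1 u1 (- L * u y).
  exact: (@is_derive_integral l u1 (fun x => - L * u x)).
have cc : continuous (csol L).
  move=> y; apply: differentiable_continuous; apply/derivable1_diffP.
  exact: (@ex_derive _ _ _ _ _ _ _ (is_derive_csol L y)).
have cs : continuous (ssol L).
  move=> y; apply: differentiable_continuous; apply/derivable1_diffP.
  exact: (@ex_derive _ _ _ _ _ _ _ (is_derive_ssol L y)).
have wc : {within `[0, l], continuous (csol L)} by exact: continuous_subspaceT.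
have ws : {within `[0, l], continuous (ssol L)} by exact: continuous_subspaceT.
pose p y := csol L y * u y - ssol L y * u1 y.
pose r y := L * (ssol L y * u y) + csol L y * u1 y.
have pE : p x = u 0.
  transitivity (p 0); last by rewrite /p csol0 ssol0 mul1r mul0r subr0.
  apply: (@is_derive_cst_on l p) => //.
  - move=> y; apply: cvgB; apply: cvgM; [exact: wc|exact: cu|exact: ws|exact: cu1].
  - move=> y yl; have h1 := du y yl; have h2 := du1 y yl.
    have h3 := is_derive_csol L y; have h4 := is_derive_ssol L y.
    by apply: is_derive_eq; rewrite /GRing.scale /=; ring.
have rE : r x = u1 0.
  transitivity (r 0); last by rewrite /r csol0 ssol0 mul1r mul0r mulr0 add0r.
  apply: (@is_derive_cst_on l r) => //.
  - move=> y; apply: cvgD; apply: cvgM; [exact: cvg_cst| |exact: wc|exact: cu1].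
    by apply: cvgM; [exact: ws|exact: cu].
  - move=> y yl; have h1 := du y yl; have h2 := du1 y yl.
    have h3 := is_derive_csol L y; have h4 := is_derive_ssol L y.
    by apply: is_derive_eq; rewrite /GRing.scale /=; ring.
have cs1 := csol_ssol_sqr L x.
rewrite -pE -rE /p /r; split.
  by rewrite -[LHS]mul1r -cs1; ring.
by rewrite -[LHS]mul1r -cs1; ring.
Qed.

Lemma ae_zero_point l (f : R -> R) a b : ae_eq mu `[0, l] f (fun=> 0) ->
  0 <= a -> a < b -> b <= l -> exists2 x, a < x < b & f x = 0.
Proof.
move=> f0 a0 ab bl; apply: contrapT => h.
have nab : mu.-negligible `]a, b[.
  apply: negligibleS f0 => x /=; rewrite in_itv /= => /andP[ax xb] fx.
  apply: h; exists x; first by rewrite ax.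
  by apply: fx; rewrite in_itv /=; lra.
have : mu `]a, b[ = 0%E by apply/negligibleP.
rewrite lebesgue_measure_itv /= lte_fin ab.
by rewrite -EFinB => /eqP; rewrite eqe subr_eq0 gt_eqF.
Qed.

(** A function that is zero almost everywhere has two zeros as close as desired, whereas a
    nontrivial solution cannot vanish at [x] and [y] if [ssol L (y - x)] is positive. *)
Lemma ae_zero_sol l L a b : 0 < l ->
  ae_eq mu `[0, l] (fun x => a * csol L x + b * ssol L x) (fun=> 0) -> a = 0 /\ b = 0.
Proof.
move=> l0 ae0; pose d := Num.min l (1 + `|L|)^-1.
have L1 : 0 < 1 + `|L| by rewrite ltr_pwDl.
have d0 : 0 < d by rewrite lt_min l0 invr_gt0.
have dl : d <= l by rewrite ge_min lexx.
have d2 : 0 < d / 2 by rewrite divr_gt0.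
have dd : d / 2 < d by rewrite ltr_pdivrMr// ltr_pMr// ltr1n.
have [x /andP[x0 xd] Ex] := ae_zero_point ae0 (lexx 0) d2 (le_trans (ltW dd) dl).
have [y /andP[dy yd] Ey] := ae_zero_point ae0 (ltW d2) dd dl.
have z0 : 0 < y - x by lra.
have zd : y - x < d by lra.
have s0 : 0 < ssol L (y - x).
  apply: ssol_gt0 => //.
  have dL : (y - x) * (1 + `|L|) < 1.
    rewrite -ltr_pdivlMr// div1r (lt_le_trans zd)//.
    by rewrite ge_min lexx orbT.
  have z1 : y - x < 1.
    apply: le_lt_trans dL; rewrite ler_peMr ?(ltW z0)//.
    by rewrite lerDl.
  have LL := ler_norm L; have Ln := normr_ge0 L.
  apply: (@le_lt_trans _ _ ((y - x) * (1 + `|L|))) => //.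
  have zz : (y - x) ^+ 2 <= y - x by rewrite expr2 ler_piMr ?(ltW z0)// ltW.
  have h1 : L * (y - x) ^+ 2 <= `|L| * (y - x) ^+ 2 by rewrite ler_wpM2r ?sqr_ge0.
  have h2 : `|L| * (y - x) ^+ 2 <= `|L| * (y - x) by rewrite ler_wpM2l.
  by rewrite mulrDr mulr1 [(y - x) * _]mulrC; lra.
have {}Ey : a * (csol L (y - x) * csol L x - L * (ssol L (y - x) * ssol L x)) +
    b * (ssol L (y - x) * csol L x + csol L (y - x) * ssol L x) = 0.
  by rewrite -csolD -ssolD subrK.
have cs1 := csol_ssol_sqr L x.
have b0 : b = 0.
  have : b * ssol L (y - x) * (csol L x ^+ 2 + L * ssol L x ^+ 2) = 0.
    move: Ex Ey; set c' := csol L (y - x); set s' := ssol L (y - x).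
    set c := csol L x; set s := ssol L x => Ex Ey.
    have -> : b * s' * (c ^+ 2 + L * s ^+ 2) =
      c * (a * (c' * c - L * (s' * s)) + b * (s' * c + c' * s))
      - (c' * c - L * (s' * s)) * (a * c + b * s) by ring.
    by rewrite Ex Ey !mulr0 subrr.
  by rewrite cs1 mulr1 => /eqP; rewrite mulf_eq0 (gt_eqF s0) orbF => /eqP.
split=> //; move: Ex Ey; rewrite b0 !mul0r !addr0 => Ex Ey; apply/eqP/negPn/negP => a0.
move/eqP: Ex; rewrite mulf_eq0 (negbTE a0) /= => /eqP c0.
move/eqP: Ey; rewrite c0 mulr0 sub0r mulf_eq0 (negbTE a0) /= oppr_eq0 => /eqP LE.
have : L * ssol L x ^+ 2 * ssol L (y - x) = 0.
  by rewrite expr2 -[RHS](mul0r (ssol L x)) -LE; ring.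
move: cs1; rewrite c0 expr0n add0r => ->; rewrite mul1r => s'0.
by rewrite s'0 ltxx in s0.
Qed.

End IntervalSobolev.

(** * Discretization of the edges *)

Section Discretization.
Context (R : realType) (E : finType) (n : nat) (l : E -> R).
Hypothesis l_gt0 : forall e, 0 < l e.

(* Values at the n + 2 equidistant points of each edge. *)
Local Notation V := {ffun E * 'I_n.+2 -> R^o}.
Implicit Types (y z : V) (e : E) (i : nat).

Definition node y e i : R := y (e, inord i).
Definition halfstep e : R := l e / (2 * n.+1%:R).

Lemma halfstep_gt0 e : 0 < halfstep e.
Proof. by rewrite divr_gt0// mulr_gt0. Qed.

Definition step e : R := halfstep e + halfstep e.
Definition pt e i : R := step e * i%:R.

Section Slopes.
Context (L : R).
Local Notation A e := (oddslope (halfstep e) L).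
Local Notation B e := (evenslope (halfstep e) L).

(* The derivatives at the right and left end of the segment between the points
   i and i + 1 of the solution of u'' = - L u interpolating y there. *)
Definition slopel y e i : R :=
  (A e * (node y e i.+1 - node y e i) + B e * (node y e i.+1 + node y e i)) / 2.
Definition sloper y e i : R :=
  (A e * (node y e i.+1 - node y e i) - B e * (node y e i.+1 + node y e i)) / 2.

(** The integral of [u' w' - L u w] for the interpolants [u] of [y] and [w] of [z]. About the
    midpoint of a segment the odd part has end values plus or minus half the difference and the even
    part half the sum, and the mixed terms cancel. *)
Definition edge_form y z : R := \sum_e \sum_(i < n.+1)
  (A e * ((node y e i.+1 - node y e i) * (node z e i.+1 - node z e i)) +
   B e * ((node y e i.+1 + node y e i) * (node z e i.+1 + node z e i))) / 2.

Lemma node_lin a y z e i : node (a *: y + z) e i = a * node y e i + node z e i.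
Proof. by rewrite /node !ffunE. Qed.

Lemma slopel_lin a y z e i : slopel (a *: y + z) e i = a * slopel y e i + slopel z e i.
Proof. by rewrite /slopel !node_lin; ring. Qed.

Lemma sloper_lin a y z e i : sloper (a *: y + z) e i = a * sloper y e i + sloper z e i.
Proof. by rewrite /sloper !node_lin; ring. Qed.

Lemma edge_form_sym : symform edge_form.
Proof.
split=> [a x y z|x y].
  rewrite /edge_form mulr_sumr -big_split; apply: eq_bigr => e _ /=.
  rewrite mulr_sumr -big_split; apply: eq_bigr => i _ /=.
  by rewrite !node_lin; field.
apply: eq_bigr => e _; apply: eq_bigr => i _.
by rewrite [X in A e * X]mulrC [X in B e * X]mulrC.
Qed.

(** Green's formula on each segment, regrouped by points: jumps of the derivative inside an edge and
    boundary terms at its ends. *)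
Lemma edge_form_slopes y z : edge_form y z = \sum_e
  (slopel y e n * node z e n.+1 - sloper y e 0 * node z e 0 +
   \sum_(i < n) (slopel y e i - sloper y e i.+1) * node z e i.+1).
Proof.
apply: eq_bigr => e _.
suff H k : \sum_(i < k.+1) (A e * ((node y e i.+1 - node y e i) * (node z e i.+1 - node z e i)) +
   B e * ((node y e i.+1 + node y e i) * (node z e i.+1 + node z e i))) / 2 =
   slopel y e k * node z e k.+1 - sloper y e 0 * node z e 0 +
   \sum_(i < k) (slopel y e i - sloper y e i.+1) * node z e i.+1 by exact: H.
elim: k => [|k IH].
  by rewrite big_ord_recr !big_ord0 /slopel /sloper /=; field.
by rewrite big_ord_recr IH [in RHS]big_ord_recr /= /slopel /sloper; field.
Qed.

Definition smooth y := forall e i, (i < n)%N -> slopel y e i = sloper y e i.+1.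

Lemma smooth_lin a y z : smooth y -> smooth z -> smooth (a *: y + z).
Proof. by move=> ys zs e i ni; rewrite slopel_lin sloper_lin ys// zs. Qed.

(** The interpolant on the first segment continued along the whole edge; it meets the other samples
    when [y] is smooth. *)
Definition lift_sol y e x : R := node y e 0 * csol L x + sloper y e 0 * ssol L x.
Definition lift_der y e x : R := node y e 0 * (- L * ssol L x) + sloper y e 0 * csol L x.

Lemma lift_sol_lin a y z e x :
  lift_sol (a *: y + z) e x = a * lift_sol y e x + lift_sol z e x.
Proof. by rewrite /lift_sol node_lin sloper_lin; ring. Qed.

Hypothesis adm : forall e, admissible (halfstep e) L.

Let c_neq0 e : csol L (halfstep e) != 0.
Proof. by rewrite gt_eqF// csolh_gt0//; exact: halfstep_gt0. Qed.

Let s_neq0 e : ssol L (halfstep e) != 0.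
Proof. by rewrite gt_eqF// ssolh_gt0//; exact: halfstep_gt0. Qed.

(** The slope is the initial derivative with which a solution starting at point [i] hits the value
    at point [i + 1]. It is unique as [ssol L (step e)], equal to [2 * (s * c)] below, is
    nonzero. *)
Lemma sloper_eq y e i d : sloper y e i = d <->
  node y e i.+1 = csol L (step e) * node y e i + ssol L (step e) * d.
Proof.
have c0 := c_neq0 e; have s0 := s_neq0 e.
have cs := csol_ssol_sqr L (halfstep e).
rewrite /sloper /step csolD ssolD /oddslope /evenslope.
set c := csol _ _ in c0 cs *; set s := ssol _ _ in s0 cs *.
set y1 := node y e i.+1; set y0 := node y e i.
have key : (c / s * (y1 - y0) - - L * s / c * (y1 + y0)) / 2 * (2 * (s * c)) =
    y1 - (c * c - L * (s * s)) * y0.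
  transitivity ((c ^+ 2 + L * s ^+ 2) * y1 - (c * c - L * (s * s)) * y0).
    by field; apply/andP.
  by rewrite cs mul1r.
have sc0 : 2 * (s * c) != 0 by rewrite !mulf_neq0.
split=> [dE|yE].
  by have := key; rewrite dE => h; apply/eqP; rewrite -subr_eq0; apply/eqP; lra.
by apply: (mulIf sc0); rewrite key yE; ring.
Qed.

Lemma slopel_eq y e i : slopel y e i =
  - L * ssol L (step e) * node y e i + csol L (step e) * sloper y e i.
Proof.
have c0 := c_neq0 e; have s0 := s_neq0 e.
have := (sloper_eq y e i _).1 erefl; set d := sloper y e i => y1.
have -> : slopel y e i = d + evenslope (halfstep e) L * (node y e i.+1 + node y e i).
  by rewrite /d /slopel /sloper; field.
rewrite y1 /evenslope /step csolD ssolD.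
have cs := csol_ssol_sqr L (halfstep e).
set c := csol _ _ in c0 cs *; set s := ssol _ _ in s0 cs *.
have LE : L * (s * s) = 1 - c * c by rewrite -cs; ring.
rewrite LE; have -> : - L * s / c = (c * c - 1) / (s * c).
  by rewrite -opprB -LE; field; apply/andP.
have -> : - L * (s * c + c * s) = 2 * c * (c * c - 1) / s.
  by rewrite -opprB -LE; field.
field; exact/andP.
Qed.

Lemma lift_smooth y e i : smooth y -> (i <= n)%N ->
  [/\ lift_sol y e (pt e i) = node y e i, lift_der y e (pt e i) = sloper y e i,
      lift_sol y e (pt e i.+1) = node y e i.+1 & lift_der y e (pt e i.+1) = slopel y e i].
Proof.
move=> ys ni.
suff [h1 h2] : lift_sol y e (pt e i) = node y e i /\ lift_der y e (pt e i) = sloper y e i.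
  split=> //; have -> : pt e i.+1 = pt e i + step e by rewrite /pt -addn1 natrD mulrDr mulr1.
    by rewrite ((sloper_eq y e i _).1 erefl) -h1 -h2 /lift_sol /lift_der csolD ssolD; ring.
  by rewrite slopel_eq -h1 -h2 /lift_sol /lift_der csolD ssolD; ring.
elim: i ni => [_|i IH ni].
  by rewrite /pt mulr0 /lift_sol /lift_der csol0 ssol0; split; ring.
have [h1 h2] := IH (ltnW ni).
have -> : pt e i.+1 = pt e i + step e by rewrite /pt -addn1 natrD mulrDr mulr1.
rewrite -ys// slopel_eq ((sloper_eq y e i _).1 erefl) -h1 -h2 /lift_sol /lift_der csolD ssolD.
by split; ring.
Qed.

Lemma pt_last e : pt e n.+1 = l e.
Proof.
have : n.+1%:R != 0 :> R by rewrite pnatr_eq0.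
by rewrite /pt /step /halfstep; set m := n.+1%:R => m0; field.
Qed.

Lemma pt_in e i : (i <= n.+1)%N -> pt e i \in `[0, l e].
Proof.
move=> ni; have s0 : 0 < step e by rewrite addr_gt0// halfstep_gt0.
rewrite in_itv /= mulr_ge0 ?(ltW s0)//= -pt_last.
by rewrite ler_wpM2l ?(ltW s0)// ler_nat.
Qed.

Definition sample (u : E -> R -> R) : V := [ffun p : E * 'I_n.+2 => (u p.1 (pt p.1 p.2) : R^o)].

Lemma node_sample u e i : (i <= n.+1)%N -> node (sample u) e i = u e (pt e i).
Proof. by move=> ni; rewrite /node ffunE /= inordK. Qed.

Lemma sample_smooth (u u1 : E -> R -> R) :
  (forall e x, x \in `[0, l e] -> u e x = u e 0 * csol L x + u1 e 0 * ssol L x /\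
     u1 e x = u e 0 * (- L * ssol L x) + u1 e 0 * csol L x) ->
  [/\ smooth (sample u),
      forall e x, x \in `[0, l e] -> u e x = lift_sol (sample u) e x &
      forall e x, x \in `[0, l e] -> u1 e x = lift_der (sample u) e x].
Proof.
move=> uE.
have ur e i : (i <= n)%N -> sloper (sample u) e i = u1 e (pt e i).
  move=> ni; apply/sloper_eq; rewrite !node_sample//; last exact: leqW.
  have [-> ->] := uE e _ (pt_in e (leqW ni)).
  have [-> _] := uE e (pt e i.+1) (@pt_in e i.+1 ni).
  have -> : pt e i.+1 = pt e i + step e by rewrite /pt -addn1 natrD mulrDr mulr1.
  by rewrite csolD ssolD; ring.
have p0 e : pt e 0 = 0 by rewrite /pt mulr0.
split=> [e i ni|e x xl|e x xl].
- rewrite slopel_eq !ur ?(ltnW ni)// !node_sample ?leqW// 1?ltnW//.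
  have [-> ->] := uE e _ (pt_in e (leqW (ltnW ni))).
  have [_ ->] := uE e (pt e i.+1) (@pt_in e i.+1 (ltnW ni)).
  have -> : pt e i.+1 = pt e i + step e by rewrite /pt -addn1 natrD mulrDr mulr1.
  by rewrite csolD ssolD; ring.
- by rewrite /lift_sol ur// node_sample// p0; have [] := uE e x xl.
- by rewrite /lift_der ur// node_sample// p0; have [] := uE e x xl.
Qed.

Lemma smooth_inj y : smooth y ->
  (forall e, node y e 0 = 0 /\ sloper y e 0 = 0) -> y = 0.
Proof.
move=> ys y0; apply/ffunP => -[e [i ni]]; rewrite ffunE.
have -> : y (e, Ordinal ni) = node y e i.
  by congr (y (_, _)); apply: val_inj; rewrite /= inordK.
have [y00 d0] := y0 e.
have lift0 x : lift_sol y e x = 0 by rewrite /lift_sol y00 d0 !mul0r addr0.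
case: i ni => [|i] ni; first by [].
by have [_ _ <- _] := lift_smooth e ys ni; rewrite lift0.
Qed.

End Slopes.
End Discretization.

Section Continuity.
Local Open Scope classical_set_scope.

Lemma oddslope_continuous (R : realType) (h t : R) : 0 < h -> admissible h t ->
  oddslope h x @[x --> t] --> oddslope h t.
Proof.
move=> h0 ht; apply/cvgrPdist_lt => e e0.
have : \forall x \near t, admissible h x.
  rewrite /admissible; have : (fun x : R => x * h ^+ 2) x @[x --> t] --> t * h ^+ 2.
    by apply: cvgM; [exact: cvg_id|exact: cvg_cst].
  by move=> /cvgr_lt; apply.
have : \forall x \near t, `|t - x| < e / h.
  exact: (nbhsx_ballx t (e / h) (divr_gt0 e0 h0)).
apply: filterS2 => x xe hx; apply: le_lt_trans (oddslope_lipschitz h0 ht hx) _.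
by rewrite mulrC -ltr_pdivlMr.
Qed.

(** Reduced to [oddslope] because the product of the two slopes is [- L]. *)
Lemma evenslope_continuous (R : realType) (h t : R) : 0 < h -> admissible h t ->
  evenslope h x @[x --> t] --> evenslope h t.
Proof.
move=> h0 ht; rewrite evenslopeE//.
have : (fun x => - x / oddslope h x) x @[x --> t] --> - t / oddslope h t.
  apply: cvgM; first by apply: cvgN; exact: cvg_id.
  by apply: cvgV; [rewrite gt_eqF// oddslope_gt0|exact: oddslope_continuous].
apply: cvg_trans; apply: near_eq_cvg.
have : \forall x \near t, admissible h x.
  rewrite /admissible; have : (fun x : R => x * h ^+ 2) x @[x --> t] --> t * h ^+ 2.
    by apply: cvgM; [exact: cvg_id|exact: cvg_cst].
  by move=> /cvgr_lt; apply.
by apply: filterS => x hx; rewrite evenslopeE.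
Qed.

End Continuity.

Section EdgeForm.
Context (R : realType) (E : finType) (n : nat) (l : E -> R).
Hypothesis l_gt0 : forall e, 0 < l e.
Local Notation V := {ffun E * 'I_n.+2 -> R^o}.
Local Notation h := (halfstep n l).
Let h_gt0 e : 0 < h e := halfstep_gt0 n l_gt0 e.

Lemma edge_form_continuous (y z : V) t : (forall e, admissible (h e) t) ->
  (edge_form l x y z @[x --> t] --> edge_form l t y z)%classic.
Proof.
move=> adm; apply: (cvg_big add_continuous) => e _; apply: (cvg_big add_continuous) => i _.
apply: cvgM; last exact: cvg_cst.
apply: cvgD; apply: cvgM; try exact: cvg_cst.
  exact: oddslope_continuous.
exact: evenslope_continuous.
Qed.

(** Interior points count twice, so that this norm, like [edge_form], is a sum over segments and can
    be compared with it term by term. *)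
Definition node_sqr (y : V) : R :=
  \sum_e \sum_(i < n.+1) (node y e i ^+ 2 + node y e i.+1 ^+ 2).

Lemma node_sqr_ge (y : V) p : (y p : R) ^+ 2 <= node_sqr y.
Proof.
case: p => e j.
have F0 e' (i : 'I_n.+1) : 0 <= node y e' i ^+ 2 + node y e' i.+1 ^+ 2.
  by rewrite addr_ge0 ?sqr_ge0.
rewrite /node_sqr (bigD1 e)//= -[X in X <= _]addr0 lerD//; last first.
  by apply: sumr_ge0 => e' _; apply: sumr_ge0 => i _; exact: F0.
have yE : y (e, j) = node y e j by rewrite /node inord_val.
rewrite yE; case: j {yE} => -[|j] jn /=.
  rewrite (bigD1 ord0)//= -[X in X <= _]addr0 lerD//; first by rewrite lerDl sqr_ge0.
  by apply: sumr_ge0 => i _; exact: F0.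
rewrite (bigD1 (Ordinal (jn : (j < n.+1)%N)))//= -[X in X <= _]addr0 lerD//.
  by rewrite lerDr sqr_ge0.
by apply: sumr_ge0 => i _; exact: F0.
Qed.

Lemma node_sqr_gt0 (y : V) : y != 0 -> 0 < node_sqr y.
Proof.
move=> y0; suff /existsP[p yp] : [exists p, y p != 0].
  by apply: lt_le_trans (node_sqr_ge y p); rewrite exprn_even_gt0.
rewrite -negb_forall; apply: contra y0 => /forallP yp.
by apply/eqP/ffunP => p; rewrite ffunE; exact/eqP.
Qed.

Lemma edge_form_decr (y : V) t t' : t < t' -> (forall e, admissible (h e) t') ->
  y != 0 -> edge_form l t' y y < edge_form l t y y.
Proof.
move=> tt' adm y0; rewrite -subr_gt0.
pose D e (i : 'I_n.+1) : R :=
  ((oddslope (h e) t - oddslope (h e) t') * (node y e i.+1 - node y e i) ^+ 2 +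
   (evenslope (h e) t - evenslope (h e) t') * (node y e i.+1 + node y e i) ^+ 2) / 2.
have -> : edge_form l t y y - edge_form l t' y y = \sum_e \sum_(i < n.+1) D e i.
  rewrite /edge_form -sumrB; apply: eq_bigr => e _; rewrite -sumrB.
  by apply: eq_bigr => i _; rewrite /D; field.
have dA e : 0 < oddslope (h e) t - oddslope (h e) t' by rewrite subr_gt0 oddslope_decr.
have dB e : 0 < evenslope (h e) t - evenslope (h e) t' by rewrite subr_gt0 evenslope_decr.
have D0 e i : 0 <= D e i.
  by rewrite divr_ge0// addr_ge0// mulr_ge0 ?sqr_ge0 ?(ltW (dA e)) ?(ltW (dB e)).
have S0 e : 0 <= \sum_(i < n.+1) D e i by exact: sumr_ge0.
rewrite lt_def sumr_ge0// andbT; apply/negP => /eqP DE.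
have := node_sqr_gt0 y0; suff -> : node_sqr y = 0 by rewrite ltxx.
rewrite /node_sqr big1// => e _; rewrite big1// => i _.
have /(_ e isT) De := psumr_eq0P (fun e _ => S0 e) DE.
have /(_ i isT) := psumr_eq0P (fun i _ => D0 e i) De; rewrite /D.
set a := node y e i; set b := node y e i.+1; move: (dA e) (dB e).
set p := _ - _; set q := _ - _ => p0 q0 pq.
have h1 : 0 <= p * (b - a) ^+ 2 by rewrite mulr_ge0 ?sqr_ge0 ?ltW.
have h2 : 0 <= q * (b + a) ^+ 2 by rewrite mulr_ge0 ?sqr_ge0 ?ltW.
have /eqP : p * (b - a) ^+ 2 = 0 by lra.
have /eqP : q * (b + a) ^+ 2 = 0 by lra.
rewrite !mulf_eq0 (gt_eqF p0) (gt_eqF q0) !orbb /= => /eqP h3 /eqP h4.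
have -> : a = 0 by lra.
have -> : b = 0 by lra.
by rewrite expr0n addr0.
Qed.

Lemma edge_form_low C : exists t0, forall t, t <= t0 ->
  forall y : V, C * node_sqr y <= edge_form l t y y.
Proof.
have lowP e := evenslope_low (h_gt0 e) C.
pose L0 e := sval (cid2 (lowP e)).
have L00 e : L0 e < 0 by rewrite /L0; case: cid2.
have L0P e L : L <= L0 e -> C <= evenslope (h e) L by rewrite /L0; case: cid2 => x ? /= +; apply.
(* All [L0 e] are negative, so their sum lies below each of them. *)
exists (\sum_e L0 e) => t tL y.
rewrite /node_sqr mulr_sumr ler_sum// => e _; rewrite mulr_sumr ler_sum// => i _.
have te : t <= L0 e.
  apply: le_trans tL _; rewrite (bigD1 e)//= gerDl.
  by apply: sumr_le0 => e' _; exact: ltW.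
have Be := L0P e t te.
have adm : admissible (h e) t.
  rewrite /admissible (le_lt_trans _ (@ltr01 R))// mulr_le0_ge0 ?sqr_ge0//.
  by rewrite (le_trans te)// ltW.
have /ltW AB := evenslope_lt_oddslope (h_gt0 e) adm.
have Ae := le_trans Be AB.
set a := node y e i; set b := node y e i.+1.
have h1 : C * (b - a) ^+ 2 <= oddslope (h e) t * (b - a) ^+ 2 by rewrite ler_wpM2r ?sqr_ge0.
have h2 : C * (b + a) ^+ 2 <= evenslope (h e) t * (b + a) ^+ 2 by rewrite ler_wpM2r ?sqr_ge0.
by rewrite ler_pdivlMr//; move: h1 h2; rewrite !expr2; lra.
Qed.

End EdgeForm.

(** * Quadratic form of a graph *)

Section GraphForm.
Context (R : realType) (E : finType) (n : nat) (G : metric_graph R E).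
Local Notation V := {ffun E * 'I_n.+2 -> R^o}.
Implicit Types (y z : V) (p : E * bool) (v : vertex G).
Let l_gt0 : forall e, 0 < len G e := len_gt0 G.

Definition end_value y p : R := node y p.1 (if p.2 then n.+1 else 0).

Definition end_slope L y p : R :=
  if p.2 then slopel (len G) L y p.1 n else - sloper (len G) L y p.1 0.

Definition some_end v : E * bool := sval (cid (endpoint_surj v)).

Lemma some_endP v : endpoint G (some_end v) = v.
Proof. by rewrite /some_end; case: cid. Qed.

Lemma end_value_lin a y z p : end_value (a *: y + z) p = a * end_value y p + end_value z p.
Proof. exact: node_lin. Qed.

Definition graph_space_spec : {U : {vspace V} | forall y, y \in U <->
  (forall p q, endpoint G p = endpoint G q -> end_value y p = end_value y q) /\
  (forall p, strength (endpoint G p) = +oo%E -> end_value y p = 0)}.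
Proof.
apply: vspace_of_pred => [|a x y [x1 x2] [y1 y2]].
  by split=> [p q _|p _]; rewrite /end_value /node !ffunE.
split=> [p q pq|p pv]; rewrite !end_value_lin; first by rewrite (x1 p q)// (y1 p q).
by rewrite x2// y2// mulr0 addr0.
Qed.

Definition graph_space := sval graph_space_spec.

Lemma graph_spaceP y : y \in graph_space <->
  (forall p q, endpoint G p = endpoint G q -> end_value y p = end_value y q) /\
  (forall p, strength (endpoint G p) = +oo%E -> end_value y p = 0).
Proof. exact: (svalP graph_space_spec). Qed.

Lemma end_value_some y p : y \in graph_space ->
  end_value y p = end_value y (some_end (endpoint G p)).
Proof. by move=> /graph_spaceP[+ _]; apply; rewrite some_endP. Qed.

(* Dirichlet vertices contribute nothing since fine +oo = 0. *)
Definition vertex_form y z : R :=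
  \sum_(v : vertex G) fine (strength v) * (end_value y (some_end v) * end_value z (some_end v)).

Definition graph_form L y z : R := edge_form (len G) L y z + vertex_form y z.

Lemma graph_form_sym L : symform (graph_form L).
Proof.
have es := edge_form_sym n (len G) L.
split=> [a x y z|x y]; rewrite /graph_form /vertex_form.
  rewrite (form_lin es) mulrDr [RHS]addrACA; congr (_ + _).
  rewrite mulr_sumr -big_split; apply: eq_bigr => v _ /=.
  by rewrite end_value_lin; ring.
rewrite (formC es); congr (_ + _); apply: eq_bigr => v _.
by rewrite [X in _ * X]mulrC.
Qed.

Definition kirchhoff L y := forall v, strength v != +oo%E ->
  \sum_(p | endpoint G p == v) end_slope L y p +
  fine (strength v) * end_value y (some_end v) = 0.

Lemma graph_formE L y z : z \in graph_space -> graph_form L y z =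
  \sum_e \sum_(i < n) (slopel (len G) L y e i - sloper (len G) L y e i.+1) * node z e i.+1 +
  \sum_(v : vertex G) (\sum_(p | endpoint G p == v) end_slope L y p +
    fine (strength v) * end_value y (some_end v)) * end_value z (some_end v).
Proof.
move=> zG; rewrite /graph_form edge_form_slopes big_split /= addrAC addrC; congr (_ + _).
have -> : \sum_e (slopel (len G) L y e n * node z e n.+1 - sloper (len G) L y e 0 * node z e 0)
   = \sum_p end_slope L y p * end_value z p.
  rewrite (eq_bigr (fun e => \sum_b end_slope L y (e, b) * end_value z (e, b))).
    by rewrite pair_bigA; apply: eq_bigr => -[].
  by move=> e _; rewrite big_bool /end_slope /end_value /= mulNr.
rewrite (partition_big (endpoint G) xpredT)//= /vertex_form -big_split /=.
apply: eq_bigr => v _; rewrite mulrDl mulr_suml mulrA; congr (_ + _).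
by apply: eq_bigr => p /eqP pv; rewrite (end_value_some _ zG) pv.
Qed.

Lemma node_ffun (F : E -> nat -> R) e i : (i <= n.+1)%N ->
  node ([ffun p : E * 'I_n.+2 => (F p.1 p.2 : R^o)] : V) e i = F e i.
Proof. by move=> ni; rewrite /node ffunE /= inordK. Qed.

Lemma radical_graphP L y : y \in radical graph_space (graph_form_sym L) <->
  [/\ y \in graph_space, smooth (len G) L y & kirchhoff L y].
Proof.
split; last first.
  move=> [yG ys yk]; apply/radicalP; split=> // z zG; rewrite graph_formE// !big1 ?addr0//.
    move=> v _; have [vy|vy] := eqVneq (strength v) +oo%E; last by rewrite yk// mul0r.
    by have /graph_spaceP[_ ->] := zG; rewrite ?mulr0// some_endP.
  by move=> e _; rewrite big1// => i _; rewrite ys// subrr mul0r.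
move=> /radicalP[yG yq]; split=> //.
- move=> e i ni.
  pose F e' j : R := ((e' == e) && (j == i.+1))%:R.
  pose z : V := [ffun p : E * 'I_n.+2 => (F p.1 p.2 : R^o)].
  have z0 p : end_value z p = 0.
    rewrite /end_value node_ffun; last by case: ifP.
    by rewrite /F; case: ifP => _; rewrite ?eqSS ?(gtn_eqF ni) ?andbF.
  have zG : z \in graph_space.
    by apply/graph_spaceP; split=> [p q _|p _]; rewrite !z0.
  have := yq z zG; rewrite graph_formE// [X in _ + X]big1 ?addr0; last first.
    by move=> v _; rewrite z0 mulr0.
  rewrite (bigD1 e)//= [X in _ + X]big1 ?addr0; last first.
    move=> e' e'e; rewrite big1// => j _.
    by rewrite node_ffun ?(leq_trans (ltn_ord j))// /F (negbTE e'e) mulr0.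
  rewrite (bigD1 (Ordinal ni))//= big1 ?addr0; last first.
    move=> j ji; rewrite node_ffun ?(leq_trans (ltn_ord j))// /F eqSS.
    by rewrite -(inj_eq val_inj) /= in ji; rewrite (negbTE ji) andbF mulr0.
  by rewrite node_ffun ?(leqW ni)// /F !eqxx mulr1 => /eqP; rewrite subr_eq0 => /eqP.
- move=> v vy.
  pose F e j : R := if j == 0%N then (endpoint G (e, false) == v)%:R
    else if j == n.+1 then (endpoint G (e, true) == v)%:R else 0.
  pose z : V := [ffun p : E * 'I_n.+2 => (F p.1 p.2 : R^o)].
  have zE p : end_value z p = (endpoint G p == v)%:R.
    by case: p => e [] ; rewrite /end_value node_ffun//= /F eqxx.
  have zG : z \in graph_space.
    apply/graph_spaceP; split=> [p q pq|p pv]; rewrite !zE ?pq//.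
    by case: eqP pv => // -> pv; rewrite pv eqxx in vy.
  have := yq z zG; rewrite graph_formE// [X in X + _]big1 ?add0r; last first.
    move=> e _; rewrite big1// => i _; rewrite node_ffun ?(leq_trans (ltn_ord i))//.
    by rewrite /F /= eqSS (ltn_eqF (ltn_ord i)) mulr0.
  rewrite (bigD1 v)//= [X in _ + X]big1 ?addr0; last first.
    by move=> w wv; rewrite zE some_endP (negbTE wv) mulr0.
  by rewrite zE some_endP eqxx mulr1.
Qed.

Context (T : R) (adm : forall e, admissible (halfstep n (len G) e) T).

Let adm_le L : L <= T -> forall e, admissible (halfstep n (len G) e) L.
Proof. by move=> LT e; exact: admissible_le LT (adm e). Qed.

Lemma graph_form_continuous t0 y z (e : R) : t0 <= T -> 0 < e ->
  \forall t \near t0, t <= T -> `|graph_form t y z - graph_form t0 y z| < e.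
Proof.
move=> t0T e0.
have /cvgrPdist_lt/(_ e e0) := @edge_form_continuous _ _ n _ l_gt0 y z _ (adm_le t0T).
apply: filterS => t te _; rewrite /graph_form distrC.
by rewrite opprD addrACA subrr addr0.
Qed.

Lemma graph_form_decr t t' y : t < t' -> t' <= T -> y != 0 ->
  graph_form t' y y < graph_form t y y.
Proof.
by move=> tt' t'T y0; rewrite ltrD2r edge_form_decr//; exact: adm_le.
Qed.

Lemma graph_form_low : exists t0, forall t, t <= t0 -> pos_on (graph_form t) graph_space.
Proof.
pose C := \sum_(v : vertex G) `|fine (strength v)|.
(* The vertex terms are at least [- C * node_sqr y], so one spare [node_sqr y] remains. *)
have [t0 tP] := edge_form_low n l_gt0 (C + 1).
exists t0 => t tt0 y _ y0; have := tP t tt0 y; have := node_sqr_gt0 y0.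
have : - (C * node_sqr y) <= vertex_form y y.
  rewrite /C mulr_suml -sumrN ler_sum// => v _.
  set g := fine _; have h : end_value y (some_end v) * end_value y (some_end v) <= node_sqr y.
    by rewrite -expr2; exact: node_sqr_ge.
  have h0 : 0 <= end_value y (some_end v) * end_value y (some_end v) by rewrite -expr2 sqr_ge0.
  have : `|g| * (end_value y (some_end v) * end_value y (some_end v)) <= `|g| * node_sqr y.
    by rewrite ler_wpM2l.
  have : - `|g| * (end_value y (some_end v) * end_value y (some_end v)) <=
      g * (end_value y (some_end v) * end_value y (some_end v)).
    by rewrite ler_wpM2r// lerNl -normrN ler_norm.
  lra.
rewrite /graph_form mulrDl mul1r; set a := C * _; set b := node_sqr _; set c := vertex_form _ _.
set d := edge_form _ _ _ _; lra.
Qed.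

End GraphForm.

(** * Effect of surgery on the form *)

Section SurgeryForm.
Context (R : realType) (E : finType) (n : nat).
Local Notation V := {ffun E * 'I_n.+2 -> R^o}.
Implicit Types (G : metric_graph R E) (y z : V) (p : E * bool).

Definition vertex_value G y (v : vertex G) : R := end_value y (some_end v).

Lemma vertex_value_lin G a x y (v : vertex G) :
  vertex_value (a *: x + y) v = a * vertex_value x v + vertex_value y v.
Proof. exact: end_value_lin. Qed.

Lemma end_valueE G y p : y \in graph_space n G ->
  end_value y p = vertex_value y (endpoint G p).
Proof. exact: end_value_some. Qed.

Lemma vertex_value_dirichlet G y (v : vertex G) : y \in graph_space n G ->
  strength v = +oo%E -> vertex_value y v = 0.
Proof. by move=> /graph_spaceP[_ +] vy; apply; rewrite some_endP. Qed.

Lemma strength_fin G (v : vertex G) : strength v != +oo%E -> strength v \is a fin_num.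
Proof. by move=> vy; rewrite fin_numE vy gt_eqF// strength_gtNy. Qed.

Section Glue.
Context G (v1 v2 : vertex G) (v12 : v1 != v2).

Let val_glue_map v : val (glue_map v12 v) = if v == v2 then v1 else v.
Proof. by rewrite /glue_map val_insubd; case: eqVneq. Qed.

Lemma glue_spaceP y : y \in graph_space n (glue v12) <->
  y \in graph_space n G /\ vertex_value y v1 - vertex_value y v2 = 0.
Proof.
split=> [yt|[yG y12]].
  have /graph_spaceP[y1 y2] := yt; split.
    apply/graph_spaceP; split=> [p q pq|p pv]; first by apply: y1; rewrite /= /glue_endpoint pq.
    apply: y2; rewrite /= /glue_strength /glue_endpoint val_glue_map.
    case: (eqVneq (endpoint G p) v2) pv => [->|pv2] pv.
      by rewrite eqxx pv addey// gt_eqF// strength_gtNy.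
    by case: eqP pv => // -> ->; rewrite addye// gt_eqF// strength_gtNy.
  rewrite /vertex_value (y1 (some_end v1) (some_end v2)) ?subrr//.
  by apply: val_inj; rewrite /= /glue_endpoint !val_glue_map !some_endP eqxx (negbTE v12).
have {}y12 : vertex_value y v1 = vertex_value y v2 by apply/eqP; rewrite -subr_eq0 y12.
have yE p : end_value y p = vertex_value y (val (glue_endpoint v12 p)).
  by rewrite (end_valueE _ yG) /glue_endpoint val_glue_map; case: eqP => [->|].
apply/graph_spaceP; split=> [p q pq|p]; first by rewrite !yE [glue_endpoint v12 p]pq.
rewrite yE /= /glue_strength; case: eqP => [-> /eqP|_]; last exact: vertex_value_dirichlet.
have [s1|s1] := eqVneq (strength v1) +oo%E; first by rewrite vertex_value_dirichlet.
have [s2|s2] := eqVneq (strength v2) +oo%E; first by rewrite y12 vertex_value_dirichlet.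
have := strength_fin s1; have := strength_fin s2.
by case: (strength v1) => // r1; case: (strength v2).
Qed.

Lemma glue_vertex_form y z :
  y \in graph_space n (glue v12) -> z \in graph_space n (glue v12) ->
  vertex_form (glue v12) y z = vertex_form G y z.
Proof.
move=> yt zt; have [yG y12] := (glue_spaceP y).1 yt; have [zG z12] := (glue_spaceP z).1 zt.
have xE x (w : vertex (glue v12)) : x \in graph_space n (glue v12) ->
    end_value x (some_end w) = vertex_value x (val w).
  move=> xt; have [xG x12] := (glue_spaceP x).1 xt; rewrite (end_valueE _ xG).
  have : glue_endpoint v12 (some_end w) = w := some_endP w.
  move=> /(congr1 val); rewrite /glue_endpoint val_glue_map; case: eqP => [-> <-|_ ->//].
  by apply/eqP; rewrite eq_sym -subr_eq0 x12.
pose F v := fine (if v == v1 then strength v1 + strength v2 else strength v)%E *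
  (vertex_value y v * vertex_value z v).
have -> : vertex_form (glue v12) y z = \sum_(v | v != v2) F v.
  rewrite /vertex_form (eq_bigr (fun w : vertex (glue v12) => F (val w))); last first.
    by move=> w _; rewrite !xE.
  exact: esym (big_sub [pred v : vertex G | v != v2] F).
rewrite /vertex_form [RHS](bigD1 v2)//= (bigD1 v1)//= [in RHS](bigD1 v1)//= addrA.
congr (_ + _); last by apply: eq_bigr => v /andP[_ /negbTE vv1]; rewrite /F vv1.
rewrite /F eqxx -!/(vertex_value _ _).
move/eqP: y12; rewrite subr_eq0 => /eqP y12; move/eqP: z12; rewrite subr_eq0 => /eqP z12.
(* As [fine +oo = 0], [fine] is not additive at an infinite strength; there the common value at [v1]
   and [v2] is 0 and both sides vanish. *)
have [s1|s1] := eqVneq (strength v1) +oo%E.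
  by rewrite -y12 (vertex_value_dirichlet yG s1) !mul0r !mulr0 addr0.
have [s2|s2] := eqVneq (strength v2) +oo%E.
  by rewrite y12 (vertex_value_dirichlet yG s2) !mul0r !mulr0 addr0.
by rewrite fineD ?strength_fin// -y12 -z12; ring.
Qed.

End Glue.

Section Raise.
Context G (v : vertex G) (g : \bar R) (vg : (strength v < g)%E).

Lemma raise_space_ltyP y : (g < +oo)%E ->
  y \in graph_space n (raise vg) <-> y \in graph_space n G.
Proof.
move=> gy.
have H (w : vertex G) : raise_strength v g w = +oo%E <-> strength w = +oo%E.
  rewrite /raise_strength; case: eqP => // ->; split=> h.
    by rewrite h ltxx in gy.
  by move: vg; rewrite h => /lt_trans/(_ gy); rewrite ltxx.
split=> /graph_spaceP[y1 y2]; apply/graph_spaceP; split=> // p pv; apply: y2; exact/H.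
Qed.

Lemma raise_space_yP y : g = +oo%E ->
  y \in graph_space n (raise vg) <-> y \in graph_space n G /\ vertex_value y v = 0.
Proof.
move=> gy; split=> [yt|[yG yv]].
  have /graph_spaceP[y1 y2] := yt; split; last first.
    by apply: y2; rewrite some_endP /= /raise_strength eqxx.
  apply/graph_spaceP; split=> // p pv; apply: y2; rewrite /= /raise_strength.
  by case: ifP.
have /graph_spaceP[y1 y2] := yG; apply/graph_spaceP; split=> // p.
rewrite /= /raise_strength; case: eqP => [pv _|_]; last exact: y2.
by rewrite (end_valueE _ yG) pv.
Qed.

(** For [g = +oo] this holds with [fine g = 0], and the extra term is 0 on the raised space, where
    the value at [v] vanishes. *)
Lemma raise_vertex_form y z : vertex_form (raise vg) y z =
  vertex_form G y z + (fine g - fine (strength v)) * (vertex_value y v * vertex_value z v).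
Proof.
rewrite /vertex_form (bigD1 v)//= [in RHS](bigD1 v)//= /raise_strength eqxx.
rewrite (eq_bigr (fun w : vertex G => fine (strength w) *
  (end_value y (some_end w) * end_value z (some_end w)))); last first.
  by move=> w /negbTE->.
by rewrite -!/(vertex_value _ _); ring.
Qed.

End Raise.

Lemma surgery_rank_one G Gt L : surgery G Gt ->
  rank_one_change (@graph_form _ _ n G L) (graph_space n G) (graph_form Gt L) (graph_space n Gt).
Proof.
case=> [v1 v2 v12|v g vg].
  exists (fun y => vertex_value y v1 - vertex_value y v2); split.
    by move=> a x y; rewrite !vertex_value_lin; ring.
  left; split=> [x|x y xt yt]; first exact: glue_spaceP.
  by rewrite /graph_form glue_vertex_form.
exists (fun y => vertex_value y v); split; first by move=> a x y; exact: vertex_value_lin.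
have [gy|gy] := eqVneq g +oo%E.
  left; split=> [x|x y xt yt]; first exact: raise_space_yP.
  have [_ xv] := (raise_space_yP vg x gy).1 xt.
  by rewrite /graph_form raise_vertex_form xv mul0r mulr0 addr0.
have gy' : (g < +oo)%E by rewrite ltey.
right; split; first by apply/vspaceP => x; apply/idP/idP => /(raise_space_ltyP vg x gy').
exists (fine g - fine (strength v)).
  have vy : strength v != +oo%E by rewrite lt_eqF// (lt_trans vg).
  have gN : g \is a fin_num by rewrite fin_numE gy gt_eqF// (lt_trans (strength_gtNy v)).
  by rewrite subr_gt0 -lte_fin !fineK// strength_fin.
by move=> x y _ _; rewrite /graph_form raise_vertex_form addrA.
Qed.

End SurgeryForm.

(** * Complex eigenspaces *)

Section L2Equality.
Context (R : realType) (E : finType) (G : metric_graph R E).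
Local Open Scope complex_scope.
Implicit Types (f g : E -> R -> R[i]).

Lemma eq_L2_refl f : eq_L2 G f f.
Proof. by move=> e; exact: ae_eq_refl. Qed.

Lemma eq_L2_sym f g : eq_L2 G f g -> eq_L2 G g f.
Proof. by move=> fg e; apply: filterS (fg e) => x h /h. Qed.

Lemma eq_L2_trans f g h : eq_L2 G f g -> eq_L2 G g h -> eq_L2 G f h.
Proof. by move=> fg gh e; apply: filterS2 (fg e) (gh e) => x h1 h2 xl; rewrite h1// h2. Qed.

Lemma eq_L2_sum m (c : 'I_m -> R[i]) (F F' : 'I_m -> E -> R -> R[i]) :
  (forall i, eq_L2 G (F i) (F' i)) ->
  eq_L2 G (fun e x => \sum_(i < m) c i * F i e x) (fun e x => \sum_(i < m) c i * F' i e x).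
Proof.
move=> FF' e; have h : {ae @lebesgue_measure R, forall x (i : 'I_m),
    `[0, len G e]%classic x -> F i e x = F' i e x}.
  exact: (filter_forall (ae_filter_ringOfSetsType (@lebesgue_measure R)) (fun i => FF' i e)).
apply: (@filterS _ _ (ae_filter_ringOfSetsType (@lebesgue_measure R)) _ _ _ h).
by move=> x hx xl; apply: eq_bigr => i _; rewrite (hx i xl).
Qed.

Lemma has_dim_le (W : (E -> R -> R[i]) -> Prop) m k :
  has_dim G W m -> has_dim G W k -> (m <= k)%N.
Proof.
move=> [b [bW bfree _]] [b' [_ _ b'span]].
pose a i := sval (cid (b'span (b i) (bW i))).
have aP i : eq_L2 G (b i) (fun e x => \sum_(j < k) a i j * b' j e x).
  by rewrite /a; case: cid.
pose A := \matrix_(i < m, j < k) a i j.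
(* A relation between the rows of the coefficient matrix would be a relation between the independent
   classes [b i]. *)
have : row_free A.
  apply: inj_row_free => v vA; apply/rowP => i; rewrite mxE.
  apply: (bfree (fun i => v 0 i)).
  apply: eq_L2_trans (eq_L2_sum _ aP) _ => e; apply: (ae_eq_trans _ (ae_eq_refl _ _ _)).
  apply: filterE => x _ /=.
  under eq_bigr do rewrite mulr_sumr.
  rewrite exchange_big big1// => j _.
  have /rowP/(_ j) := vA; rewrite !mxE => vAj.
  transitivity ((\sum_i v 0 i * A i j) * b' j e x); last by rewrite vAj mul0r.
  by rewrite mulr_suml; apply: eq_bigr => l _; rewrite mxE mulrA.
by rewrite /row_free => /eqP <-; exact: rank_leq_col.
Qed.

Lemma has_dim_unique (W : (E -> R -> R[i]) -> Prop) m k :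
  has_dim G W m -> has_dim G W k -> m = k.
Proof. by move=> h1 h2; apply/eqP; rewrite eqn_leq !(has_dim_le h1 h2, has_dim_le h2 h1). Qed.

Lemma has_dim_ext (W W' : (E -> R -> R[i]) -> Prop) m :
  (forall f, W f <-> W' f) -> has_dim G W m -> has_dim G W' m.
Proof.
move=> WW' [b [bW bfree bspan]]; exists b; split=> // [i|f /WW'/bspan//].
exact/WW'.
Qed.

End L2Equality.

Section Eigenspace.
Context (R : realType) (E : finType) (n : nat) (G : metric_graph R E) (L : R).
Local Notation V := {ffun E * 'I_n.+2 -> R^o}.
Local Notation l := (len G).
Local Notation mu := (@lebesgue_measure R).
Local Open Scope complex_scope.
Implicit Types (y z : V) (p : E * bool) (v : vertex G).
Hypothesis adm : forall e, admissible (halfstep n l e) L.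
Let l_gt0 : forall e, 0 < len G e := len_gt0 G.

Definition real_trace (u : E -> R -> R) p : R := u p.1 (if p.2 then l p.1 else 0).
Definition real_normal (u1 : E -> R -> R) p : R :=
  if p.2 then real_trace u1 p else - real_trace u1 p.

Definition real_vertex_condition (u u1 : E -> R -> R) v := exists c : R,
  (forall p, endpoint G p = v -> real_trace u p = c) /\
  match strength v with
  | g%:E => \sum_(p | endpoint G p == v) real_normal u1 p + g * c = 0
  | _ => c = 0
  end.

Definition real_eigenfunction (u u1 : E -> R -> R) :=
  (forall e x, x \in `[0, l e] -> u e x = u e 0 * csol L x + u1 e 0 * ssol L x /\
     u1 e x = u e 0 * (- L * ssol L x) + u1 e 0 * csol L x) /\
  forall v, real_vertex_condition u u1 v.

Lemma end_of_sample u p : end_value (sample n l u) p = real_trace u p.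
Proof.
case: p => e [] /=; rewrite /end_value /real_trace /= node_sample//.
  by rewrite pt_last.
by rewrite /pt mulr0.
Qed.

Lemma end_of_lift y p : smooth l L y -> end_value y p = real_trace (lift_sol l L y) p.
Proof.
move=> ys; case: p => e [] /=; rewrite /end_value /real_trace /=.
  by have [_ _ <- _] := lift_smooth l_gt0 adm e ys (leqnn n); rewrite pt_last.
by rewrite /lift_sol csol0 ssol0 mulr1 mulr0 addr0.
Qed.

Lemma end_slope_of_lift y p : smooth l L y ->
  end_slope G L y p = real_normal (lift_der l L y) p.
Proof.
move=> ys; case: p => e [] /=; rewrite /end_slope /real_normal /real_trace /=.
  by have [_ _ _ <-] := lift_smooth l_gt0 adm e ys (leqnn n); rewrite pt_last.
by rewrite /lift_der csol0 ssol0 mulr1 !mulr0 add0r.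
Qed.

Lemma real_eigenfunction_lift y : y \in radical (graph_space n G) (graph_form_sym n G L) ->
  real_eigenfunction (lift_sol l L y) (lift_der l L y).
Proof.
move=> /radical_graphP[yG ys yk]; split.
  by move=> e x _; rewrite /lift_sol /lift_der csol0 ssol0; split; ring.
move=> v; exists (vertex_value y v); split.
  by move=> p <-; rewrite -end_of_lift// (end_valueE _ yG).
have := @vertex_value_dirichlet _ _ _ _ _ v yG; have := yk v; have := strength_gtNy v.
case: (strength v) => [g _ /(_ isT) + _|_ _|//]; last by apply.
by under eq_bigr do rewrite end_slope_of_lift//.
Qed.

Lemma real_eigenfunction_sample u u1 : real_eigenfunction u u1 ->
  (sample n l u) \in radical (graph_space n G) (graph_form_sym n G L) /\
  forall e x, x \in `[0, l e] -> u e x = lift_sol l L (sample n l u) e x.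
Proof.
move=> [uE uv]; have [us ul u1l] := sample_smooth l_gt0 adm uE.
split=> //; apply/radical_graphP; split=> //.
  apply/graph_spaceP; split=> [p q pq|p pv]; rewrite !end_of_sample.
    by have [c [h _]] := uv (endpoint G p); rewrite !h.
  by have [c [h]] := uv (endpoint G p); rewrite pv h.
move=> v vy; have [c [h]] := uv v; move: vy (strength_gtNy v).
case: (strength v) => // g _ _ hv; rewrite -[RHS]hv /=; congr (_ + _ * _).
  apply: eq_bigr => p _; rewrite end_slope_of_lift//.
  case: p => e [] /=; rewrite /real_normal /real_trace /= u1l// in_itv /= lexx ?ltW//.
by rewrite end_of_sample h// some_endP.
Qed.

Lemma ReD (a b : R[i]) : complex.Re (a + b) = complex.Re a + complex.Re b.
Proof. by case: a; case: b. Qed.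

Lemma ImD (a b : R[i]) : complex.Im (a + b) = complex.Im a + complex.Im b.
Proof. by case: a; case: b. Qed.

Lemma Re_sum I (r : seq I) (P : pred I) (F : I -> R[i]) :
  complex.Re (\sum_(i <- r | P i) F i) = \sum_(i <- r | P i) complex.Re (F i).
Proof. by elim/big_ind2 : _ => // a b c d <- <-; rewrite ReD. Qed.

Lemma Im_sum I (r : seq I) (P : pred I) (F : I -> R[i]) :
  complex.Im (\sum_(i <- r | P i) F i) = \sum_(i <- r | P i) complex.Im (F i).
Proof. by elim/big_ind2 : _ => // a b c d <- <-; rewrite ImD. Qed.

Lemma ReZ (a : R) (b : R[i]) : complex.Re (a%:C * b) = a * complex.Re b.
Proof. by case: b => b1 b2 /=; rewrite mul0r subr0. Qed.

Lemma ImZ (a : R) (b : R[i]) : complex.Im (a%:C * b) = a * complex.Im b.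
Proof. by case: b => b1 b2 /=; rewrite mul0r addr0. Qed.

Lemma complex_eqP (a b : R[i]) :
  complex.Re a = complex.Re b -> complex.Im a = complex.Im b -> a = b.
Proof. by case: a => a1 a2; case: b => b1 b2 /= -> ->. Qed.

Lemma vertex_conditionP (f f1 : E -> R -> R[i]) v : vertex_condition f f1 v <->
  real_vertex_condition (fun e x => complex.Re (f e x)) (fun e x => complex.Re (f1 e x)) v /\
  real_vertex_condition (fun e x => complex.Im (f e x)) (fun e x => complex.Im (f1 e x)) v.
Proof.
have nRe p : complex.Re (normal_derivative G f1 p) = real_normal (fun e x => complex.Re (f1 e x)) p.
  by rewrite /normal_derivative /real_normal /trace /real_trace; case: p.2; case: (f1 _ _).
have nIm p : complex.Im (normal_derivative G f1 p) = real_normal (fun e x => complex.Im (f1 e x)) p.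
  by rewrite /normal_derivative /real_normal /trace /real_trace; case: p.2; case: (f1 _ _).
split=> [[c [fc cv]]|[[a [fa av]] [b [fb bv]]]].
  split; [exists (complex.Re c)|exists (complex.Im c)]; (split;
    first by move=> p /fc <-); case: (strength v) cv => [g||] cv; rewrite ?cv//.
    have := congr1 (@complex.Re R) cv; rewrite ReD Re_sum ReZ => h; apply: etrans h.
    by congr (_ + _); apply: eq_bigr => p _; rewrite nRe.
  have := congr1 (@complex.Im R) cv; rewrite ImD Im_sum ImZ => h; apply: etrans h.
  by congr (_ + _); apply: eq_bigr => p _; rewrite nIm.
exists (a +i* b); split.
  by move=> p pv; apply: complex_eqP; [rewrite -(fa p pv)|rewrite -(fb p pv)].
case: (strength v) av bv => [g||] av bv; rewrite ?av ?bv//.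
apply: complex_eqP; rewrite ?ReD ?ImD ?Re_sum ?Im_sum ?ReZ ?ImZ /=.
  by apply: etrans av; congr (_ + _); apply: eq_bigr => p _; rewrite nRe.
by apply: etrans bv; congr (_ + _); apply: eq_bigr => p _; rewrite nIm.
Qed.

Definition complex_lift y z : E -> R -> R[i] :=
  fun e x => lift_sol l L y e x +i* lift_sol l L z e x.

Lemma complex_lift_sum m (c : 'I_m -> R[i]) (y : 'I_m -> V) e x :
  \sum_(i < m) c i * complex_lift (y i) 0 e x =
  complex_lift (\sum_(i < m) complex.Re (c i) *: y i) (\sum_(i < m) complex.Im (c i) *: y i) e x.
Proof.
have l0 : lift_sol l L (0 : V) e x = 0.
  by have := lift_sol_lin l L 1 (0 : V) 0 e x; rewrite scaler0 addr0 mul1r; lra.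
have lS (a : 'I_m -> R) : lift_sol l L (\sum_(i < m) a i *: y i) e x =
    \sum_(i < m) a i * lift_sol l L (y i) e x.
  have lD : {morph (fun w : V => lift_sol l L w e x) : a b / a + b}.
    by move=> a1 a2; rewrite -[a1]scale1r lift_sol_lin mul1r scale1r.
  rewrite (big_morph _ lD l0); apply: eq_bigr => i _.
  by rewrite -[_ *: _]addr0 lift_sol_lin l0 addr0.
apply: complex_eqP; rewrite /= ?Re_sum ?Im_sum lS; apply: eq_bigr => i _.
  by case: (c i) => a b /=; rewrite l0 mulr0 subr0.
by case: (c i) => a b /=; rewrite l0 mulr0 add0r.
Qed.

Lemma complex_lift_inj y z y' z' : smooth l L y -> smooth l L z ->
  smooth l L y' -> smooth l L z' ->
  eq_L2 G (complex_lift y z) (complex_lift y' z') -> y = y' /\ z = z'.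
Proof.
have H (a b : V) : smooth l L a -> smooth l L b ->
    (forall e, ae_eq mu `[0, l e]%classic (lift_sol l L a e) (lift_sol l L b e)) -> a = b.
  move=> asm bsm ab; apply/eqP; rewrite -subr_eq0 addrC -scaleN1r; apply/eqP.
  apply: (smooth_inj l_gt0 adm); first exact: smooth_lin.
  move=> e; have := ab e => abe; apply: (@ae_zero_sol R (l e) L) => //.
  apply: filterS abe => x h xl.
  by rewrite -[LHS]/(lift_sol l L (-1 *: b + a) e x) lift_sol_lin (h xl) mulN1r addNr.
move=> ys zs ys' zs' yz; split; apply: H => // e; apply: filterS (yz e) => x h xl.
  exact: (congr1 (@complex.Re R) (h xl)).
exact: (congr1 (@complex.Im R) (h xl)).
Qed.

(** The complexification of [K]: a real basis of [K] is a complex basis, the real and imaginary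
    parts of the coefficients being the coordinates of [y] and [z]. *)
Lemma has_dim_lift (K : {vspace V}) : (forall y, y \in K -> smooth l L y) ->
  has_dim G (fun f => exists y z, [/\ y \in K, z \in K & eq_L2 G f (complex_lift y z)]) (\dim K).
Proof.
move=> Ks; pose b (i : 'I_(\dim K)) := (vbasis K)`_i.
have bK i : b i \in K by rewrite vbasis_mem// mem_nth// size_tuple.
have sK (a : 'I_(\dim K) -> R) : \sum_i a i *: b i \in K.
  by rewrite memv_suml// => i _; rewrite memvZ.
exists (fun i => complex_lift (b i) 0); split.
- by move=> i; exists (b i), 0; rewrite mem0v bK; split=> //; exact: eq_L2_refl.
- move=> c c0.
  have /complex_lift_inj : eq_L2 G
      (complex_lift (\sum_i complex.Re (c i) *: b i) (\sum_i complex.Im (c i) *: b i))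
      (complex_lift 0 0).
    apply: eq_L2_trans (eq_L2_trans c0 _).
      by move=> e; apply: filterE => x _; rewrite complex_lift_sum.
    move=> e; apply: filterE => x _.
    (* The sum formula with no summands says that the lift of 0 is 0. *)
    have := complex_lift_sum (fun i : 'I_0 => 0) (fun=> 0) e x.
    by rewrite !big_ord0.
  case; [exact: Ks|exact: Ks|apply: Ks; exact: mem0v|apply: Ks; exact: mem0v|].
  have /basis_free/freeP bf : basis_of K (vbasis K) by exact: vbasisP.
  by move=> /bf cRe /bf cIm i; apply: complex_eqP; [exact: cRe|exact: cIm].
- move=> f [y [z [yK zK fyz]]].
  exists (fun i => coord (vbasis K) i y +i* coord (vbasis K) i z).
  apply: eq_L2_trans fyz _ => e; apply: filterE => x _.
  by rewrite complex_lift_sum /= -!coord_vbasis.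
Qed.

Lemma eigenspaceP f : laplacian_eigenspace G L f <-> exists y z,
  [/\ y \in radical (graph_space n G) (graph_form_sym n G L),
      z \in radical (graph_space n G) (graph_form_sym n G L) & eq_L2 G f (complex_lift y z)].
Proof.
split=> [[u [u1 [u2 [uH uv fu fu2]]]]|[y [z [yZ zZ fyz]]]].
  have u2E e : ae_eq mu `[0, l e]%classic (u2 e) (fun x => - (L%:C * u e x)).
    by apply: filterS2 (fu e) (fu2 e) => x h1 h2 xl; rewrite -h1// h2// opprK.
  have uRe : real_eigenfunction (fun e x => complex.Re (u e x)) (fun e x => complex.Re (u1 e x)).
    split=> [e x xl|v]; last by have /vertex_conditionP[] := uv v.
    have [h1 _ h2 _] := uH e; apply: (eigenfunction_edge (l_gt0 e) h1 h2) xl.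
    apply: filterS (u2E e) => t h tl; rewrite (h tl) mulNr -ReZ.
    by case: (_ * _).
  have uIm : real_eigenfunction (fun e x => complex.Im (u e x)) (fun e x => complex.Im (u1 e x)).
    split=> [e x xl|v]; last by have /vertex_conditionP[] := uv v.
    have [_ h1 _ h2] := uH e; apply: (eigenfunction_edge (l_gt0 e) h1 h2) xl.
    apply: filterS (u2E e) => t h tl; rewrite (h tl) mulNr -ImZ.
    by case: (_ * _).
  have [yZ yl] := real_eigenfunction_sample uRe.
  have [zZ zl] := real_eigenfunction_sample uIm.
  exists (sample n l (fun e x => complex.Re (u e x))), (sample n l (fun e x => complex.Im (u e x))).
  split=> //; apply: eq_L2_trans fu _ => e; apply: filterE => x xl.
  by apply: complex_eqP; rewrite /= -?yl -?zl.
have [yE yv] := real_eigenfunction_lift yZ; have [zE zv] := real_eigenfunction_lift zZ.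
exists (complex_lift y z), (fun e x => lift_der l L y e x +i* lift_der l L z e x),
  (fun e x => - L%:C * complex_lift y z e x).
have cont (g g1 : R -> R) : (forall x : R, is_derive x 1 g (g1 x)) -> continuous g.
  move=> dg x; apply: differentiable_continuous; apply/derivable1_diffP.
  exact: (@ex_derive _ _ _ _ _ _ _ (dg x)).
have dsol (w : V) (e : E) (x : R) : is_derive x 1 (lift_sol l L w e) (lift_der l L w e x).
  have h3 := is_derive_csol L x; have h4 := is_derive_ssol L x.
  by apply: is_derive_eq; rewrite /lift_der /GRing.scale /=; ring.
have dder (w : V) (e : E) (x : R) : is_derive x 1 (lift_der l L w e) (- L * lift_sol l L w e x).
  have h3 := is_derive_csol L x; have h4 := is_derive_ssol L x.
  by apply: is_derive_eq; rewrite /lift_sol /GRing.scale /=; ring.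
have csol' (w : V) (e : E) := cont _ _ (dsol w e).
have cder (w : V) (e : E) := cont _ _ (dder w e).
have H2 (w : V) (e : E) : is_H1 (l e) (lift_der l L w e) (fun x => - L * lift_sol l L w e x).
  apply: is_H1_of_derive => //.
  by move=> x; apply: cvgM; [exact: cvg_cst|exact: csol'].
split=> //.
- move=> e.
  have E2 (w : V) (F : R -> R) : (forall x, F x = - L * lift_sol l L w e x) ->
      is_H1 (l e) (lift_der l L w e) F by move=> /funext->; exact: H2.
  split.
  + exact: (is_H1_of_derive (l_gt0 e) (dsol y e) (cder y e)).
  + exact: (is_H1_of_derive (l_gt0 e) (dsol z e) (cder z e)).
  + by apply: (E2 y) => x /=; ring.
  + by apply: (E2 z) => x /=; ring.
- by move=> v; apply/vertex_conditionP; split; [exact: yv|exact: zv].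
- by move=> e; apply: filterS (fyz e) => x h xl; rewrite h// mulNr opprK.
Qed.

End Eigenspace.

(** * Eigenvalue counting and interlacing *)

Section Counting.
Context (R : realType) (E : finType).
Implicit Types (G : metric_graph R E).

Lemma exists_subdivision (l : E -> R) T : exists n, forall e, admissible (halfstep n l e) T.
Proof.
pose S := \sum_e `|T| * l e ^+ 2.
have S0 : 0 <= S by apply: sumr_ge0 => e _; rewrite mulr_ge0 ?sqr_ge0.
(* The requirement is [T * l e ^ 2 < (2 * (n + 1)) ^ 2], and already [n + 1] exceeds [S]. *)
exists (Num.bound S) => e; set n := Num.bound S.
have Sn : S < n.+1%:R by apply: lt_trans (archi_boundP S0) _; rewrite ltr_nat.
have Tl : T * l e ^+ 2 <= S.
  apply: (@le_trans _ _ (`|T| * l e ^+ 2)); first by rewrite ler_wpM2r ?sqr_ge0// ler_norm.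
  rewrite /S (bigD1 e)//= lerDl sumr_ge0// => e' _.
  by rewrite mulr_ge0 ?sqr_ge0.
rewrite /admissible /halfstep expr_div_n mulrA ltr_pdivrMr ?exprn_gt0 ?mulr_gt0// mul1r.
apply: le_lt_trans Tl (lt_le_trans Sn _).
have : 1 <= n.+1%:R :> R by rewrite ler1n.
by set m := n.+1%:R => m1; rewrite expr2; nra.
Qed.

Section Fixed.
Context (n : nat) (T : R) (G : metric_graph R E).
Hypothesis adm : forall e, admissible (halfstep n (len G) e) T.

Lemma multiplicity_radical L : L <= T ->
  multiplicity G L (\dim (radical (graph_space n G) (graph_form_sym n G L))).
Proof.
move=> LT; have admL e := admissible_le LT (adm e).
apply: has_dim_ext (has_dim_lift admL _) => [f|y /radical_graphP[]//].
by split=> /(eigenspaceP admL).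
Qed.

Lemma eigenvalue_index lam k t : eigenvalue_sequence G lam -> t <= T ->
  lam k < t <-> index_ge (@graph_form _ _ n G t) (graph_space n G) k.+1.
Proof.
move=> [lam_mono lam_mult] tT.
have qc := @graph_form_continuous _ _ n G T adm.
have qd t1 t2 (y : {ffun E * 'I_n.+2 -> R^o}) : t1 < t2 -> t2 <= T ->
    y \in graph_space n G -> y != 0 -> graph_form G t2 y y < graph_form G t1 y y.
  by move=> t12 t2T _; exact: (graph_form_decr adm t12 t2T).
have lc L : L <= T ->
    ([set j | lam j = L] #= `I_(\dim (radical (graph_space n G) (graph_form_sym n G L))))%card.
  move=> LT; have [m Lm] := lam_mult L.
  by rewrite (has_dim_unique Lm (multiplicity_radical LT)).
split; first exact: (index_ge_of_lam qd lam_mono lc).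
exact: (lam_lt_of_index_ge qc (graph_form_low n G) lam_mono lc).
Qed.

End Fixed.

Lemma surgery_len G Gt : surgery G Gt -> len Gt = len G :> (E -> R).
Proof. by case. Qed.

End Counting.

Theorem theorem3p4 (R : realType) (E : finType) (G Gt : metric_graph R E) :
  surgery G Gt ->
  (forall lam lamt : nat -> R,
     eigenvalue_sequence G lam -> eigenvalue_sequence Gt lamt ->
     forall k : nat,
       [/\ lam k <= lamt k, lamt k <= lam k.+1 & lam k.+1 <= lamt k.+1]) /\
  (forall (L : R) (m mt : nat),
     multiplicity G L m -> multiplicity Gt L mt ->
     [/\ (m <= mt + 1)%N, (mt <= m + 1)%N &
         has_dim G
           (fun f => laplacian_eigenspace G L f /\ laplacian_eigenspace Gt L f)
           (minn m mt)]).
Proof.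
move=> GGt; have lGt := surgery_len GGt; split=> [lam lamt lamP lamtP|L m mt Gm Gtm].
  have lower k : lam k <= lamt k.
    (* At the parameter [lam k], a smaller [lamt k] would give [Gt], hence [G], index at least
       [k + 1], that is [lam k < lam k]. The next bound is the same at [lamt k], with one dimension
       lost from [G] to [Gt]. *)
    rewrite leNgt; apply/negP => lt; have [n adm] := exists_subdivision (len G) (lam k).
    have admt e : admissible (halfstep n (len Gt) e) (lam k) by rewrite lGt.
    have /(change_index_le (surgery_rank_one n (lam k) GGt)) :=
      (eigenvalue_index admt k lamtP (lexx _)).1 lt.
    by move=> /(eigenvalue_index adm k lamP (lexx _)); rewrite ltxx.
  have upper k : lamt k <= lam k.+1.
    rewrite leNgt; apply/negP => lt; have [n adm] := exists_subdivision (len G) (lamt k).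
    have admt e : admissible (halfstep n (len Gt) e) (lamt k) by rewrite lGt.
    have /(change_index_ge (surgery_rank_one n (lamt k) GGt)) :=
      (eigenvalue_index adm k.+1 lamP (lexx _)).1 lt.
    by move=> /(eigenvalue_index admt k lamtP (lexx _)); rewrite ltxx.
  by move=> k.
have [n adm] := exists_subdivision (len G) L.
have admt e : admissible (halfstep n (len Gt) e) L by rewrite lGt.
rewrite (has_dim_unique Gm (multiplicity_radical adm (lexx L))).
rewrite (has_dim_unique Gtm (multiplicity_radical admt (lexx L))).
set Z := radical _ _; set Zt := radical _ (graph_form_sym n Gt L).
have [ZZt ZtZ <-] := change_radical (surgery_rank_one n L GGt)
  (graph_form_sym n G L) (graph_form_sym n Gt L).
split=> //.
have Zs y : y \in Z -> smooth (len G) L y by move=> /radical_graphP[].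
have Zts y : y \in Zt -> smooth (len G) L y by move=> /radical_graphP[]; rewrite lGt.
apply: has_dim_ext (has_dim_lift adm _) => [f|y]; last by rewrite memv_cap => /andP[/Zs].
have liftE y z : complex_lift Gt L y z = complex_lift G L y z by rewrite /complex_lift lGt.
split=> [[y [z [/[!memv_cap]/andP[yZ yZt] /andP[zZ zZt] fyz]]]|].
  split; [apply/(eigenspaceP adm)|apply/(eigenspaceP admt)]; exists y, z; split=> //.
  by rewrite liftE /eq_L2 lGt.
(* The class [f] has a sample from each graph; lifts depend only on the edge lengths and are
   injective, so the two samples coincide and lie in both radicals. *)
move=> [/(eigenspaceP adm)[y [z [yZ zZ fyz]]] /(eigenspaceP admt)[y' [z' [yZ' zZ' fyz']]]].
rewrite liftE /eq_L2 lGt -/(eq_L2 G _ _) in fyz'.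
have [yy' zz'] := complex_lift_inj adm (Zs _ yZ) (Zs _ zZ) (Zts _ yZ') (Zts _ zZ')
  (eq_L2_trans (eq_L2_sym fyz) fyz').
by exists y, z; rewrite !memv_cap yZ zZ [in y \in _]yy' [in z \in _]zz'.
Qed.
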